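(* Fix $\alpha\in(0,1)$ and $L>0$. Let $\phi_n^*$ be the test that rejects when $T_n>c_{\alpha,n}$, where $T_n=\max_{1\le k\le n}\sqrt{k}\,\hat g_k$ and $c_{\alpha,n}$ is the $1-\alpha$ quantile of $T_n$ under $g\equiv 0$. Then $\phi_n^*$ has level $\alpha$ for the null hypothesis that $g(x)\le 0$ for all $x\in\mathrm{supp}(X_1)$, i.e. $E_g\phi_n^*\le\alpha$ for every such $g$. Furthermore, there exists a constant $C^*$ such that, for all $\varepsilon\in(0,1]$, $$\lim_{n\to\infty}\ \inf_{\beta\in[\varepsilon,1]}\ \inf_{g\in\mathcal{G}(C^*(n/\log\log n)^{-\beta/(2\beta+1)},L,\beta)} E_g\phi_n^*=1 .$$
   Context: Model: for each $n$ (with $n\ge 3$ whenever $\log\log n$ appears) one observes i.i.d. pairs of real random variables $(X_i,Y_i)$, $i=1,\dots,n$, with $Y_i=g(X_i)+\varepsilon_i$, $\varepsilon_i\mid X_i\sim N(0,\sigma^2(X_i))$, $X_i\sim F_X$, where $F_X$ is a c.d.f. and $g:\mathbb{R}\to\mathbb{R}$ is the regression function. The distribution $F_X$ and the conditional variance function $\sigma^2$ are fixed and known, and for some $\eta>0$ they satisfy $$\eta t\le |F_X(t)-F_X(-t)|\le t/\eta,\qquad \eta\le\sigma^2(x)\le 1/\eta\qquad\text{for all } |x|<\eta,\ 0<t<\eta.$$ The point $0$ may be on the boundary of the support of $X_i$. $E_g$ denotes expectation when the regression function is $g$. $\mathrm{supp}(X_1)$ is the support of $F_X$. A test is identified with its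 rejection indicator. Nearest neighbor estimator: for $k\in\{1,\dots,n\}$ let $|X_{(k)}|$ be the $k$th least value of $|X_1|,\dots,|X_n|$. With $\eta>0$ the same constant for which $F_X$ and $\sigma^2$ satisfy $\eta t\le |F_X(t)-F_X(-t)|\le t/\eta$ and $\eta\le\sigma^2(x)\le 1/\eta$ for all $|x|<\eta$, $0<t<\eta$, $\hat g_k=\frac1k\sum_{j:\,|X_j|\le|X_{(k)}|}Y_j$ if $|X_{(k)}|<\eta$, and $\hat g_k=0$ otherwise. For $L>0$ and $0\le\beta\le1$, $\Sigma(L,\beta)=\{g:\ |g(x)-g(x')|\le L|x-x'|^\beta \text{ for all } x,x'\}$, and for $b\in\mathbb{R}$, $\mathcal{G}(b,L,\beta)=\{g:\ g(0)\ge b \text{ and } g\in\Sigma(L,\beta)\}$. *)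

(* Defs.v *)
From HB Require Import structures.
From mathcomp Require Import all_boot all_order all_algebra.
From mathcomp Require Import all_classical all_reals all_analysis.

Set Implicit Arguments.
Unset Strict Implicit.
Unset Printing Implicit Defensive.

Import Order.TTheory GRing.Theory Num.Theory.
Import numFieldNormedType.Exports.

Local Open Scope classical_set_scope.
Local Open Scope ring_scope.

(* Points of increase of a distribution function. *)
Definition cdf_support (R : realType) (F : R -> R) : set R :=
  [set x | forall e, 0 < e -> F (x - e) < F (x + e)].

(* N(m, v), parametrized by its variance [v]. The library's [normal_prob m 0]
   is not the point mass at [m], hence the case distinction. *)
Definition gaussian (R : realType) (m v : R) (B : set R) : \bar R :=
  if v == 0 then \d_m B else normal_prob m (Num.sqrt v) B.

Definition independent_family d d' (Omega : measurableType d) (R : realType)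
    (P : probability Omega R) (E : measurableType d') (I : finType)
    (Z : I -> Omega -> E) : Prop :=
  forall A : I -> set E, (forall i, measurable (A i)) ->
    P (\bigcap_(i in [set: I]) Z i @^-1` A i) =
    (\prod_(i : I) P (Z i @^-1` A i))%E.

(* [e] given [X] is N(0, s2 X): the kernel x |-> N(0, s2 x) is a regular
   conditional distribution of [e] given [X]. *)
Definition conditionally_centered_gaussian d (Omega : measurableType d)
    (R : realType) (P : probability Omega R) (s2 : R -> R)
    (X e : {RV P >-> R}) : Prop :=
  forall A B : set R, measurable A -> measurable B ->
    P (X @^-1` A `&` e @^-1` B) =
    (\int[P]_(w in X @^-1` A) gaussian 0 (s2 (X w)) B)%E.

(* Design points [X i] and errors [e i]; for a regression function [g], the
   observations are the pairs (X i, g (X i) + e i). *)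
Definition regression_sample d (Omega : measurableType d) (R : realType)
    (P : probability Omega R) (n : nat) (F s2 : R -> R)
    (X e : 'I_n -> {RV P >-> R}) : Prop :=
  [/\ forall i r, cdf (X i) r = (F r)%:E,
      forall i, conditionally_centered_gaussian s2 (X i) (e i)
    & independent_family P (fun i w => (X i w, e i w))].

Section statistic.
Context {R : realType} {n : nat} (eta : R) (x y : 'I_n -> R).

Definition kth_least_abs (k : nat) : R :=
  nth 0 (sort <=%R [seq `|x i| | i <- enum 'I_n]) k.-1.

Definition nn_estimator (k : nat) : R :=
  if kth_least_abs k < eta then
    k%:R^-1 * \sum_(j < n | `|x j| <= kth_least_abs k) y j
  else 0.

(* The default value of the maximum is the term k = 1, so this is the genuine
   maximum over 1 <= k <= n as soon as 0 < n. *)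
Definition max_statistic : R :=
  \big[Num.max/Num.sqrt 1%:R * nn_estimator 1]_(1 <= k < n.+1)
    (Num.sqrt k%:R * nn_estimator k).

End statistic.

Definition quantile d (Omega : measurableType d) (R : realType)
    (P : probability Omega R) (T : Omega -> R) (p : R) : R :=
  inf [set t | (p%:E <= P [set w | (T w <= t)%R])%E].

Section test.
Context d (Omega : measurableType d) (R : realType) (P : probability Omega R).
Context (n : nat) (eta alpha : R) (X e : 'I_n -> {RV P >-> R}).

Definition Tn (g : R -> R) (w : Omega) : R :=
  max_statistic eta (X^~ w) (fun i => g (X i w) + e i w).

Definition critical_value : R := quantile P (Tn (cst 0)) (1 - alpha).

Definition rejection_prob (g : R -> R) : \bar R :=
  'E_P[\1_[set w | critical_value < Tn g w]].

End test.

Definition Holder_class (R : realType) (L beta : R) : set (R -> R) :=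
  [set g | forall x x', `|g x - g x'| <= L * `|x - x'| `^ beta].

Definition alternative (R : realType) (b L beta : R) : set (R -> R) :=
  [set g | b <= g 0 /\ Holder_class L beta g].

Definition rate (R : realType) (n : nat) (beta : R) : R :=
  (n%:R / ln (ln n%:R)) `^ (- (beta / (2 * beta + 1))).

(* Main.v *)
Require Import Defs.
From HB Require Import structures.
From mathcomp Require Import all_boot all_order all_algebra.
From mathcomp Require Import all_classical all_reals all_analysis.
From mathcomp Require Import measurable_realfun.
From mathcomp Require Import ring lra.

Set Implicit Arguments.
Unset Strict Implicit.
Unset Printing Implicit Defensive.

Import Order.TTheory GRing.Theory Num.Theory.
Import numFieldNormedType.Exports.

Local Open Scope classical_set_scope.
Local Open Scope ring_scope.

(** Under the null hypothesis [g = 0], ties make the numerators of the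
    estimators sums of the errors over the prefix sets [{i : |X_i| <= |X_j|}].
    Since the errors are symmetric given the design, the law of the sample is
    invariant under sign flips of the errors.  Averaging over all sign patterns,
    the prefix sums become Rademacher sums with fixed coefficients, to which
    Levy's maximal inequality and a subgaussian tail apply.  Cut [|x| < eta] into
    dyadic shells of radii [K 2^i / n]: on each shell the number of points and
    the sum of the squared errors are controlled by Chebyshev's inequality, with
    failure probabilities summable in [i], and the maximal prefix sum exceeds
    [const * sqrt (n r log log n)] with probability [O((log n)^-2)].  There are
    [O(log n)] shells, so the critical value is [O(sqrt (log log n))].

    Under the alternative, take the [k] for which the [k] nearest points are
    those in [|x| < h], where [n h^(2 beta + 1) = log log n].  The signal in
    [sqrt k * g_k] is then of order [C * sqrt (log log n)] and the noise is
    [O(sqrt (log log n))] by the same one-shell bound, whose failure probability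
    is [O(1 / log log n)], uniformly in [beta] and [g].

    The level holds because [T_n] is monotone in the observations and almost
    every design point lies in the support. *)

(** * Rademacher sums *)

Section rademacher.
Local Open Scope set_scope.
Local Open Scope ring_scope.
Context {R : realType} {I : finType}.
Implicit Types (a r : I -> R) (s : {ffun I -> bool}).

(** For [2 * x ^+ 2 > 1] both exponents are at most [2 * x ^+ 2]. Otherwise [exp y <= 1 / (1 - y)]
    at [x] and [- x] gives [2 / (1 - x ^+ 2)], and [1 / (1 - x ^+ 2) <= 1 + 2 * x ^+ 2]. The factor
    2 in the exponent, instead of the sharp 1/2, keeps this elementary. *)
Lemma expR_sum_opp_le (x : R) : expR x + expR (- x) <= 2 * expR (2 * x ^+ 2).
Proof.
have [x2|x2] := leP (2 * x ^+ 2) 1; last first.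
  have e1 : forall y, y ^+ 2 = x ^+ 2 -> expR y <= expR (2 * x ^+ 2).
    by move=> y yx; rewrite ler_expR; nra.
  have := e1 x erefl; have := e1 (- x) (sqrrN x); lra.
have inv_bound y : y ^+ 2 = x ^+ 2 -> expR y <= (1 - y)^-1.
  move=> yx; have y1 : 0 < 1 - y by nra.
  rewrite -[expR y]invrK -expRN lef_pV2 ?posrE ?expR_gt0//.
  exact: expR_ge1Dx.
have x21 : 0 < 1 - x ^+ 2 by nra.
apply: (@le_trans _ _ (2 * (1 - x ^+ 2)^-1)).
  apply: (le_trans (lerD (inv_bound x erefl) (inv_bound (- x) (sqrrN x)))).
  have x1 : 1 - x != 0 by apply: lt0r_neq0; nra.
  have x1' : 1 - - x != 0 by apply: lt0r_neq0; nra.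
  have x1'' : 1 - x ^+ 2 != 0 by apply: lt0r_neq0.
  suff -> : (1 - x)^-1 + (1 - - x)^-1 = 2 * (1 - x ^+ 2)^-1 by [].
  have -> : 1 - x ^+ 2 = (1 - x) * (1 - - x) by ring.
  by field; rewrite x1; move: x1'; rewrite opprK => ->.
rewrite ler_pM2l// -[leRHS]invrK -expRN lef_pV2 ?posrE ?expR_gt0//.
rewrite expRN -[leRHS]invrK lef_pV2 ?posrE ?invr_gt0 ?expR_gt0//.
apply: (@le_trans _ _ (1 + 2 * x ^+ 2)); last exact: expR_ge1Dx.
by rewrite -[leLHS]mul1r ler_pdivrMr//; nra.
Qed.

(** Chernoff's method, with the uniform law on sign patterns written as a count: the exponential
    moment factors over the coordinates. *)
Lemma rademacher_tail a (v lam : R) : 0 < v -> 0 <= lam ->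
  \sum_i a i ^+ 2 <= v ->
  #|[set s : {ffun I -> bool} | lam < \sum_i (-1) ^+ (s i) * a i]|%:R <=
    2 ^+ #|I| * expR (- (lam ^+ 2 / (8 * v))).
Proof.
move=> v0 lam0 av.
(* This [t] minimizes [2 * t ^+ 2 * v - t * lam], with minimum [- (lam ^+ 2 / (8 * v))]. *)
pose t := lam / (4 * v).
have t0 : 0 <= t by rewrite divr_ge0// ltW// mulr_gt0.
pose E s := expR (t * \sum_i (-1) ^+ (s i) * a i).
have sumE : \sum_s E s = \prod_i (expR (t * a i) + expR (- (t * a i))).
  under [RHS]eq_bigr => i _.
    have -> : expR (t * a i) + expR (- (t * a i)) =
       \sum_(b : bool) expR (t * ((-1) ^+ b * a i)).
      by rewrite big_bool /= expr1 mulN1r mulrN expr0 mul1r addrC.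
    over.
  rewrite bigA_distr_bigA /=; apply: eq_bigr => s _.
  by rewrite /E mulr_sumr expR_sum.
have sumE_le : \sum_s E s <= 2 ^+ #|I| * expR (2 * t ^+ 2 * v).
  rewrite sumE; apply: (@le_trans _ _ (\prod_(i : I) (2 * expR (2 * (t * a i) ^+ 2)))).
    apply: ler_prod => i _; rewrite expR_sum_opp_le andbT.
    by rewrite addr_ge0 ?expR_ge0.
  rewrite big_split /= prodr_const -expR_sum ler_pM2l ?exprn_gt0// ler_expR.
  under eq_bigr do rewrite exprMn mulrA.
  by rewrite -mulr_sumr ler_wpM2l// mulr_ge0// sqr_ge0.
have -> : - (lam ^+ 2 / (8 * v)) = 2 * t ^+ 2 * v - t * lam.
  by rewrite /t; field; apply: lt0r_neq0.
rewrite expRD expRN mulrA ler_pdivlMr ?expR_gt0//.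
apply: le_trans sumE_le.
rewrite -sum1_card natr_sum mulr_suml.
rewrite [leRHS](bigID (mem [set s : {ffun I -> bool} | lam < \sum_i (-1) ^+ (s i) * a i])) /=.
apply: ler_wpDr; first by apply: sumr_ge0 => s _; exact: expR_ge0.
apply: ler_sum => s; rewrite inE => ls.
by rewrite mul1r ler_expR ler_wpM2l// ltW.
Qed.

Lemma rademacher_tail_norm a (v lam : R) : 0 < v -> 0 <= lam ->
  \sum_i a i ^+ 2 <= v ->
  #|[set s : {ffun I -> bool} | lam < `|\sum_i (-1) ^+ (s i) * a i|]|%:R <=
    2 * (2 ^+ #|I| * expR (- (lam ^+ 2 / (8 * v)))).
Proof.
move=> v0 lam0 av.
have aNv : \sum_i (- a i) ^+ 2 <= v.
  by under eq_bigr do rewrite sqrrN.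
rewrite mulr_natl mulr2n.
apply: le_trans (lerD (rademacher_tail v0 lam0 av) (rademacher_tail v0 lam0 aNv)).
rewrite -natrD ler_nat.
apply: (leq_trans _ (leq_card_setU _ _).1); apply: subset_leq_card.
apply/fintype.subsetP => s; rewrite !inE lter_normr.
by under [X in _ -> _ || (_ < X)]eq_bigr do rewrite mulrN; rewrite sumrN.
Qed.

(* Reflection: flipping the signs after the first exceedance is injective, and
   a partial sum is the mean of the total sum and of its reflection. *)
Lemma levy_maximal a r (lam : R) :
  (#|[set s : {ffun I -> bool} |
       [exists j, (lam < `|\sum_(i | r i <= r j) (-1) ^+ (s i) * a i|)%R]]| <=
   2 * #|[set s : {ffun I -> bool} | (lam < `|\sum_i (-1) ^+ (s i) * a i|)%R]|)%N.
Proof.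
pose S s j := \sum_(i | r i <= r j) (-1) ^+ (s i) * a i.
pose bad s j := lam < `|S s j|.
set B := [set s : {ffun I -> bool} | _]; set T := [set s | lam < _].
(* The choice of [j] among ties is immaterial: a prefix set depends on [j] only through [r j]. *)
pose refl s : {ffun I -> bool} :=
  if [pick j | bad s j] is Some j0 then
    let j := [arg min_(j < j0 | bad s j) r j]%O in
    [ffun i => if r i <= r j then s i else ~~ s i]
  else s.
have reflP s : s \in B -> exists j, [/\ bad s j,
    forall j', bad s j' -> (r j <= r j')%R &
    refl s = [ffun i => if r i <= r j then s i else ~~ s i]].
  rewrite inE => /existsP[j1 bj1]; rewrite /refl; case: pickP => [j0 bj0|/(_ j1)].
    case: arg_minP => // j bj jmin; exists j; split=> // j' /jmin.
  by rewrite /bad /S bj1.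
have S_refl s s' j j' : (r j' <= r j)%R ->
    s' = [ffun i => if r i <= r j then s i else ~~ s i] -> S s' j' = S s j'.
  move=> jj' ->; apply: eq_bigr => i ij'.
  by rewrite ffunE (le_trans ij' jj').
(* Reflection keeps the level of the first exceedance, so that level can be read off the reflected
   pattern and the flip undone. *)
have refl_min s : s \in B -> forall j, [/\ bad s j & forall j', bad s j' -> (r j <= r j')%R] ->
   [/\ bad (refl s) j & forall j', bad (refl s) j' -> (r j <= r j')%R].
  move=> sB j [bj jmin]; have [j2 [bj2 jmin2 e]] := reflP _ sB.
  have rj : r j = r j2 by apply/eqP; rewrite eq_le jmin// jmin2.
  have Se j' : (r j' <= r j)%R -> S (refl s) j' = S s j'.
    by move=> ?; apply: S_refl e; rewrite -rj.
  split; first by rewrite /bad Se.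
  move=> j' bj'; rewrite leNgt; apply/negP => jj'.
  move: bj'; rewrite /bad Se ?ltW// => /jmin.
  by rewrite leNgt jj'.
have refl_inj : {in B &, injective refl}.
  move=> s s' sB s'B e.
  have [j [bj jmin es]] := reflP _ sB; have [j' [bj' jmin' es']] := reflP _ s'B.
  have [bj1 m1] := refl_min _ sB j (conj bj jmin).
  have [bj2 m2] := refl_min _ s'B j' (conj bj' jmin').
  have rj : r j = r j'.
    by apply/eqP; rewrite eq_le m1 ?m2// ?e// -e.
  apply/ffunP => i; move: e; rewrite es es' => /ffunP/(_ i); rewrite !ffunE rj.
  by case: ifP => // _ /negb_inj.
(* The two total sums have the exceeding partial sum as their mean, so they cannot both be small. *)
have sub : B \subset (T :|: [set s in B | refl s \in T]).
  apply/fintype.subsetP => s sB; rewrite finset.in_setU [X in _ || X]inE sB /= !inE.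
  have [j [bj jmin es]] := reflP _ sB.
  rewrite !ltNge -negb_and; apply/negP => /andP[h1 h2].
  move: bj; rewrite /bad ltNge => /negP; apply.
  have -> : S s j = 2^-1 * (\sum_i (-1) ^+ (s i) * a i + \sum_i (-1) ^+ (refl s i) * a i).
    rewrite (bigID (fun i => r i <= r j) predT)/=.
    rewrite [X in _ + X](bigID (fun i => r i <= r j) predT)/=.
    have -> : \sum_(i | r i <= r j) (-1) ^+ refl s i * a i = S s j.
      exact: S_refl (lexx _) es.
    have -> : \sum_(i | ~~ (r i <= r j)) (-1) ^+ refl s i * a i =
       - \sum_(i | ~~ (r i <= r j)) (-1) ^+ s i * a i.
      rewrite -sumrN; apply: eq_bigr => i /negbTE ij; rewrite es ffunE ij signrN.
      by rewrite mulNr.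
    by rewrite -/(S s j); field.
  rewrite normrM ger0_norm//.
  by have := ler_normD (\sum_i (-1) ^+ (s i) * a i) (\sum_i (-1) ^+ (refl s i) * a i); lra.
apply: (leq_trans (subset_leq_card sub)); apply: (leq_trans (leq_card_setU _ _).1).
rewrite mul2n -addnn leq_add2l.
rewrite -(card_in_imset (f := refl)); last first.
  move=> s s'; rewrite !inE => /andP[sB _] /andP[s'B _]; apply: refl_inj; by rewrite inE.
apply: subset_leq_card; apply/fintype.subsetP => _ /imsetP[s + ->].
by rewrite inE => /andP[].
Qed.

Lemma rademacher_maximal a r (v lam : R) : 0 < v -> 0 <= lam ->
  \sum_i a i ^+ 2 <= v ->
  #|[set s : {ffun I -> bool} |
      [exists j, lam < `|\sum_(i | r i <= r j) (-1) ^+ (s i) * a i|]]|%:R <=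
    2 ^+ #|I| * (4 * expR (- (lam ^+ 2 / (8 * v)))).
Proof.
move=> v0 lam0 av; have := rademacher_tail_norm v0 lam0 av.
have := levy_maximal a r lam; rewrite -(ler_nat R) natrM => h1 h2.
apply: (le_trans h1).
have -> : 4 = 2 * 2 :> R by ring.
by rewrite mulrCA -mulrA ler_pM2l// mulrCA.
Qed.

End rademacher.

(** * Laws of independent samples *)

Section laws.
Context d (Omega : measurableType d) (R : realType) (P : probability Omega R).

Lemma measurable_tuple_of n d' (T : measurableType d') (Z : 'I_n -> Omega -> T) :
  (forall i, measurable_fun setT (Z i)) ->
  measurable_fun setT (fun w => [tuple Z i w | i < n]).
Proof.
move=> mZ; apply/measurable_fun_tnthP => i.
rewrite (_ : _ \o _ = Z i) //.
by apply/funext => w /=; rewrite tnth_mktuple.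
Qed.

(** Boxes, unlike preimages under a single coordinate, are stable under intersection, as the
    uniqueness theorem for measures requires. *)
Lemma measurable_tuple_boxes n d' (T : measurableType d') :
  @measurable _ (n.-tuple T) =
  <<s [set E | exists2 A : 'I_n -> set T, (forall i, measurable (A i)) &
                E = [set z | forall i, A i (tnth z i)]] >>.
Proof.
apply/seteqP; split.
  apply: smallest_sub; first exact: smallest_sigma_algebra.
  rewrite -bigcup_seq => E [i _ [B mB <-]].
  apply: sub_gen_smallest.
  exists (fun j => if j == i then B else setT) => [j|]; first by case: ifP.
  rewrite setTI; apply/seteqP; split=> [z Bz j|z /(_ i)]; last by rewrite eqxx.
  by case: eqP => // ->.
apply: smallest_sub; first exact: sigma_algebra_measurable.
move=> _ [A mA ->].
rewrite (_ : mkset _ = \bigcap_(i in [set: 'I_n]) (tnth (T:=T) ^~ i) @^-1` A i).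
  apply: fin_bigcap_measurable => // i _.
  by rewrite -[X in measurable X]setTI; exact: measurable_tnth.
by apply/seteqP; split=> z Az i //=; apply: Az.
Qed.

(** On a box both laws are the product of the marginals, and the boxes determine a finite
    measure. *)
Lemma independent_law_eq n d' (T : measurableType d') (Z Z' : 'I_n -> Omega -> T) :
  (forall i, measurable_fun setT (Z i)) ->
  (forall i, measurable_fun setT (Z' i)) ->
  independent_family P Z -> independent_family P Z' ->
  (forall i A, measurable A -> P (Z i @^-1` A) = P (Z' i @^-1` A)) ->
  forall E : set (n.-tuple T), measurable E ->
    P ((fun w => [tuple Z i w | i < n]) @^-1` E) =
    P ((fun w => [tuple Z' i w | i < n]) @^-1` E).
Proof.
move=> mZ mZ' iZ iZ' ZZ' E mE.
have mt := measurable_tuple_of mZ; have mt' := measurable_tuple_of mZ'.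
pose m1 := distribution P (mfun_Sub (mem_set mt)).
pose m2 := distribution P (mfun_Sub (mem_set mt')).
suff : m1 E = m2 E by [].
apply: (measure_unique _ (fun=> setT) (measurable_tuple_boxes n T)) => //.
- move=> _ _ [A mA ->] [B mB ->]; exists (fun i => A i `&` B i) => [i|].
    exact: measurableI.
  apply/seteqP; split=> [z [Az Bz] i|z ABz]; first by split.
  by split=> i; have [] := ABz i.
- by move=> _; exists (fun=> setT) => //; apply/seteqP.
- by rewrite bigcup_const.
- move=> _ [A mA ->].
  have E1 (W : 'I_n -> Omega -> T) :
      (fun w => [tuple W i w | i < n]) @^-1` [set z | forall i, A i (tnth z i)] =
      \bigcap_(i in [set: 'I_n]) W i @^-1` A i.
    apply/seteqP; split=> w Aw i; first by move=> _; have := Aw i; rewrite tnth_mktuple.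
    by rewrite tnth_mktuple; exact: Aw.
  set A' := [set z | _].
  change (P ((fun w => [tuple Z i w | i < n]) @^-1` A') =
          P ((fun w => [tuple Z' i w | i < n]) @^-1` A')).
  rewrite !E1 iZ// iZ'//.
  by apply: eq_bigr => i _; exact: ZZ'.
- move=> _; apply: (le_lt_trans (probability_le1 _ _)) => //; exact: ltry.
Qed.

Lemma independent_family_comp (I : finType) d' (T : measurableType d')
    (Z : I -> Omega -> T) (f : I -> T -> T) :
  (forall i, measurable_fun setT (f i)) ->
  independent_family P Z -> independent_family P (fun i w => f i (Z i w)).
Proof.
move=> mf iZ A mA.
have := iZ (fun i => f i @^-1` A i); apply=> i.
by rewrite -[X in measurable X]setTI; exact: mf.
Qed.

End laws.

(** * Symmetry and domination of centered Gaussian laws *)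

Section gaussian.
Context {R : realType}.

Lemma gaussian_symmetric (v : R) (B : set R) : 0 <= v -> measurable B ->
  gaussian 0 v (-%R @^-1` B) = gaussian 0 v B.
Proof.
move=> v_ge0 mB; rewrite /gaussian; case: eqVneq => [_|v0].
  rewrite !diracE; congr (_%:R%:E); congr nat_of_bool.
  by apply/idP/idP; rewrite !inE/= oppr0.
have s0 : Num.sqrt v != 0 by rewrite sqrtr_eq0 -ltNge lt_neqAle eq_sym v0.
have mpdf : measurable_fun setT (fun x : R => (normal_pdf 0 (Num.sqrt v) x)%:E : \bar R).
  by apply/measurable_EFinP; exact: measurable_normal_pdf.
rewrite /normal_prob.
transitivity (\int[lebesgue_measure]_(x in (-%R : _ -> measurableTypeR R) @^-1` B)
   ((fun x : R => (normal_pdf 0 (Num.sqrt v) x)%:E) \o -%R) x)%E.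
  apply: eq_integral => x _ /=.
  by rewrite normal_pdfE// /normal_fun !subr0 sqrrN.
rewrite -ge0_integral_pushforward//=; last 2 first.
- exact: measurable_funTS mpdf.
- by move=> x _; rewrite lee_fin normal_pdf_ge0.
by apply: eq_measure_integral => A mA AS; exact: lebesgue_measureN.
Qed.

Lemma gaussian_ge0 (v : R) (B : set R) : (0 <= gaussian 0 v B)%E.
Proof.
by rewrite /gaussian; case: ifP.
Qed.

(* The constant [eta^-1] bounds the ratio [sqrt (eta^-1 / v)] of the
   normalizing factors. *)
Lemma gaussian_dominated (eta v : R) (B : set R) : 0 < eta -> eta <= v <= eta^-1 ->
  measurable B ->
  (gaussian 0 v B <= eta^-1%:E * normal_prob 0 (Num.sqrt eta^-1) B)%E.
Proof.
move=> eta0 /andP[ev ve] mB.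
have v0 : 0 < v by apply: lt_le_trans ev.
have ei0 : 0 < eta^-1 by rewrite invr_gt0.
have sv0 : Num.sqrt v != 0 by rewrite gt_eqF// sqrtr_gt0.
have se0 : Num.sqrt eta^-1 != 0 by rewrite gt_eqF// sqrtr_gt0.
rewrite /gaussian gt_eqF// /normal_prob.
rewrite -ge0_integralZl_EFin//; last 3 first.
- by move=> x _; rewrite lee_fin normal_pdf_ge0.
- apply/measurable_EFinP; apply: measurable_funTS; exact: measurable_normal_pdf.
- exact: ltW.
apply: ge0_le_integral => //.
- by move=> x _; rewrite lee_fin normal_pdf_ge0.
- apply/measurable_EFinP; apply: measurable_funTS; exact: measurable_normal_pdf.
- apply/measurable_EFinP; apply: measurable_funM => //.
  apply: measurable_funTS; exact: measurable_normal_pdf.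
move=> x _; rewrite -EFinM lee_fin !normal_pdfE// mulrA.
rewrite /normal_peak /normal_fun !sqr_sqrtr ?(ltW v0) ?(ltW ei0)//.
apply: ler_pM; rewrite ?invr_ge0 ?sqrtr_ge0 ?expR_ge0//.
- rewrite -[leRHS]invrK lef_pV2 ?posrE; last 2 first.
  + by rewrite sqrtr_gt0 mulrn_wgt0// mulr_gt0// pi_gt0.
  + by rewrite invr_gt0 mulr_gt0// invr_gt0 sqrtr_gt0 mulrn_wgt0// mulr_gt0// pi_gt0.
  rewrite invfM !invrK -ler_sqr ?nnegrE ?sqrtr_ge0//; last first.
    by rewrite mulr_ge0 ?sqrtr_ge0// ltW.
  rewrite exprMn !sqr_sqrtr; last 2 first.
  + by rewrite mulrn_wge0// mulr_ge0 ?pi_ge0// ltW.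
  + by rewrite mulrn_wge0// mulr_ge0 ?pi_ge0// ltW.
  have -> : eta ^+ 2 * (eta^-1 * pi *+ 2) = eta * pi *+ 2.
    by rewrite mulrnAr mulrA expr2 mulfK// gt_eqF.
  by rewrite lerMn2r/= ler_pM2r ?pi_gt0.
- rewrite ler_expR !mulNr lerN2 ler_wpM2l ?sqr_ge0//.
  by rewrite lef_pV2 ?posrE ?mulrn_wgt0// lerMn2r.
Qed.

End gaussian.

(** * Gaussian moments *)

Section normal_moment.
Context {R : realType}.
Import HBNNSimple.

(** Each simple function below [f] can be integrated against the density; the supremum gives the
    direction of the change of density that upper bounds on moments use. *)
Lemma ge0_integral_normal_prob_le (m s : R) (f : R -> R) :
  (forall x, 0 <= f x) -> measurable_fun setT f ->
  (\int[normal_prob m s]_x (f x)%:E <=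
   \int[lebesgue_measure]_x (f x * normal_pdf m s x)%:E)%E.
Proof.
move=> f0 mf; have mpdf := measurable_normal_pdf m s.
rewrite ge0_integralTE; last by move=> x; rewrite lee_fin.
apply: ge_ereal_sup => _ [h /= hf <-].
rewrite sintegralE.
have -> : (\sum_(x \in range h) x%:E * normal_prob m s (h @^-1` [set x]) =
   \int[lebesgue_measure]_x (\sum_(r \in range h)
      (r * \1_(h @^-1` [set r]) x * normal_pdf m s x)%:E))%E.
  rewrite ge0_integral_fsum//.
  - apply: eq_fsbigr => r; rewrite inE => -[y _ <-].
    rewrite /normal_prob -ge0_integralZl_EFin//; last 2 first.
    + by move=> x _; rewrite lee_fin normal_pdf_ge0.
    + by apply/measurable_EFinP; apply: measurable_funTS.
    rewrite [LHS]integral_mkcond; apply: eq_integral => x _; rewrite /patch indicE.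
    by case: ifP => _; rewrite ?mulr1 ?mulr0 ?mul0r// EFinM.
  - move=> r; apply/measurable_EFinP; apply: measurable_funM => //.
    exact: measurable_funM.
  - move=> r x _; rewrite lee_fin mulr_ge0 ?normal_pdf_ge0//.
    exact: nnfun_muleindic_ge0.
apply: ge0_le_integral => //.
- move=> x _; rewrite fsume_ge0// => r _.
  rewrite lee_fin mulr_ge0 ?normal_pdf_ge0//.
  exact: nnfun_muleindic_ge0.
- apply: emeasurable_fsum => // r; apply/measurable_EFinP; apply: measurable_funM => //.
  exact: measurable_funM.
- by apply/measurable_EFinP; apply: measurable_funM.
move=> x _; rewrite fsumEFin// lee_fin -mulr_fsuml -fimfunE ler_wpM2r ?normal_pdf_ge0//.
by rewrite -lee_fin; exact: hf.
Qed.

(** Half of the Gaussian exponent absorbs the polynomial, as [(u / 2) ^+ 2 <= exp u]; the other half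
    is the exponent for variance [2 * s ^+ 2]. *)
Lemma expr4_normal_fun_le (s x : R) : 0 < s ->
  x ^+ 4 * normal_fun 0 s x <= 64 * s ^+ 4 * normal_fun 0 (Num.sqrt 2 * s) x.
Proof.
move=> s0; rewrite /normal_fun !subr0 exprMn sqr_sqrtr//.
have s0' : s != 0 by rewrite gt_eqF.
rewrite -[s ^+ 2 *+ 2]mulr_natl -[2 * s ^+ 2 *+ 2]mulr_natl.
have -> : - x ^+ 2 / (2 * s ^+ 2) =
    - x ^+ 2 / (2 * (2 * s ^+ 2)) - x ^+ 2 / (2 * (2 * s ^+ 2)) by field.
set u := x ^+ 2 / (2 * (2 * s ^+ 2)).
have u0 : 0 <= u by rewrite /u divr_ge0 ?sqr_ge0// mulr_ge0// mulr_ge0// sqr_ge0.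
have -> : x ^+ 4 = 64 * s ^+ 4 * (u / 2) ^+ 2.
  by rewrite /u; field.
rewrite mulNr -/u.
have -> : 64 * s ^+ 4 * (u / 2) ^+ 2 * expR (- u - u) =
    64 * s ^+ 4 * expR (- u) * ((u / 2) ^+ 2 * expR (- u)) by rewrite expRD; ring.
apply: ler_piMr.
  by rewrite mulr_ge0 ?expR_ge0// mulr_ge0// exprn_ge0// ltW.
rewrite expRN ler_pdivrMr ?expR_gt0// mul1r.
have -> : expR u = expR (u / 2) ^+ 2 by rewrite expr2 -expRD; congr expR; lra.
have := expR_ge1Dx (u / 2); have : 0 <= u / 2 by rewrite divr_ge0.
by move: (u / 2) (expR (u / 2)) => a b; nra.
Qed.

(** The summand 1 makes the integrand dominate [|x|], [x ^+ 2] and [x ^+ 4] at once, so one constant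
    serves for all the moments below. *)
Lemma normal_fourth_moment (s : R) : 0 < s ->
  exists2 M : R, 0 < M &
    (\int[normal_prob 0 s]_x (1 + x ^+ 4)%:E <= M%:E)%E.
Proof.
move=> s0.
have s20 : Num.sqrt 2 * s != 0 by rewrite gt_eqF// mulr_gt0// sqrtr_gt0.
have sn0 : s != 0 by rewrite gt_eqF.
pose K := 64 * s ^+ 4 * (normal_peak s / normal_peak (Num.sqrt 2 * s)).
have K0 : 0 < K.
  by rewrite /K mulr_gt0// ?divr_gt0 ?normal_peak_gt0// mulr_gt0// exprn_gt0.
exists (1 + K); first by rewrite addr_gt0.
have mf : measurable_fun setT (fun x : R => 1 + x ^+ 4).
  by apply: measurable_funD => //; exact: exprn_measurable.
have f0 (x : R) : 0 <= 1 + x ^+ 4 by rewrite addr_ge0// exprn_even_ge0.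
apply: (le_trans (ge0_integral_normal_prob_le _ _ f0 mf)).
apply: (@le_trans _ _ (\int[lebesgue_measure]_x
   ((normal_pdf 0 s x)%:E + (K * normal_pdf 0 (Num.sqrt 2 * s) x)%:E))%E).
  apply: ge0_le_integral => //.
  - by move=> x _; rewrite lee_fin mulr_ge0 ?normal_pdf_ge0.
  - apply/measurable_EFinP; apply: measurable_funM => //; exact: measurable_normal_pdf.
  - apply/measurable_EFinP; apply: measurable_funD; first exact: measurable_normal_pdf.
    by apply: measurable_funM => //; exact: measurable_normal_pdf.
  move=> x _; rewrite -EFinD lee_fin mulrDl mul1r lerD2l.
  have pdfE s' : s' != 0 -> normal_pdf 0 s' x = normal_peak s' * normal_fun 0 s' x.
    by move=> ?; rewrite normal_pdfE.
  rewrite !pdfE// mulrCA.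
  have p0 := normal_peak_gt0 s20; have p1 := normal_peak_gt0 sn0.
  have -> : K * (normal_peak (Num.sqrt 2 * s) * normal_fun 0 (Num.sqrt 2 * s) x) =
     normal_peak s * (64 * s ^+ 4 * normal_fun 0 (Num.sqrt 2 * s) x).
    have : normal_peak (Num.sqrt 2 * s) != 0 by rewrite gt_eqF.
    rewrite /K; move: (normal_peak (Num.sqrt 2 * s)) (normal_peak s) (normal_fun _ _ _).
    by move=> u v f u0; field.
  by rewrite ler_pM2l// expr4_normal_fun_le.
rewrite ge0_integralD//; last 4 first.
- by move=> x _; rewrite lee_fin normal_pdf_ge0.
- by apply/measurable_EFinP; exact: measurable_normal_pdf.
- by move=> x _; rewrite lee_fin mulr_ge0 ?normal_pdf_ge0// ltW.
- apply/measurable_EFinP; apply: measurable_funM => //; exact: measurable_normal_pdf.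
under [X in (_ + X)%E]eq_integral do rewrite EFinM.
rewrite ge0_integralZl_EFin//; last 3 first.
- by move=> x _; rewrite lee_fin normal_pdf_ge0.
- by apply/measurable_EFinP; exact: measurable_normal_pdf.
- exact: ltW.
by rewrite !integral_normal_pdf// mule1 EFinD.
Qed.

End normal_moment.

(** * Conditionally Gaussian errors *)

Section nonneg_integrals.
Import HBNNSimple.

(** Going through simple functions below [f] covers an [f] whose measurability is not at hand, such
    as [w |-> gaussian 0 (s2 (X w)) B]. *)
Lemma ge0_le_integral_cst d (T : measurableType d) (R : realType)
    (mu : {measure set T -> \bar R}) (D : set T) (f : T -> \bar R) (c : R) :
  measurable D -> 0 <= c -> (forall x, D x -> (0 <= f x)%E) ->
  (forall x, D x -> (f x <= c%:E)%E) ->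
  (\int[mu]_(x in D) f x <= c%:E * mu D)%E.
Proof.
move=> mD c0 f0 fc; rewrite ge0_integralE//.
apply: ge_ereal_sup => _ [h /= hf <-].
apply: (@le_trans _ _ (\int[mu]_x (h x)%:E)%E).
  by rewrite ge0_integralTE => [|x]; [apply: ereal_sup_ubound; exists h | rewrite lee_fin].
rewrite -integral_cst// [leRHS]integral_mkcond.
apply: ge0_le_integral => //.
- by move=> x _; rewrite lee_fin.
- exact/measurable_EFinP.
- exact/(measurable_restrictT _ _).1.
move=> x _; apply: (le_trans (hf x)); rewrite /patch; case: ifP => //.
by rewrite inE => /fc.
Qed.

(** A nonnegative simple function below the restriction of [f] to [D] vanishes off [D], so its
    nonzero levels have the same mass under both measures. *)
Lemma ge0_integral_mrestr_ge d (T : measurableType d) (R : realType)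
    (mu : {measure set T -> \bar R}) (D : set T) (mD : measurable D)
    (f : T -> \bar R) : (forall x, (0 <= f x)%E) ->
  (\int[mu]_(x in D) f x <= \int[mrestr mu mD]_x f x)%E.
Proof.
move=> f0; rewrite ge0_integralE// ge0_integralTE//.
apply: ge_ereal_sup => _ [h /= hf <-].
apply: ereal_sup_ubound; exists h => [x|/=].
  by apply: (le_trans (hf x)); rewrite /patch; case: ifP.
rewrite !sintegralE; apply: eq_fsbigr => r _.
have [->|r0] := eqVneq r 0; first by rewrite !mul0e.
congr (_ * _)%E; rewrite /= /mrestr setIidl// => x /= hx.
apply: contrapT => xD; have := hf x; rewrite hx /patch ifF ?lee_fin.
  by rewrite leNgt lt_neqAle eq_sym r0 -hx fun_ge0.
by apply/negP; rewrite inE.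
Qed.

End nonneg_integrals.

Section conditional_gaussian.
Context d (Omega : measurableType d) (R : realType) (P : probability Omega R).
Variables (s2 : R -> R) (X e : {RV P >-> R}).
Hypothesis s2_ge0 : forall x, 0 <= s2 x.
Hypothesis eX : conditionally_centered_gaussian s2 X e.

(** Rectangles suffice by uniqueness of measures; on a rectangle the conditional law of the error is
    a centered Gaussian, which is symmetric. *)
Lemma flip_error_law (A : set (R * R)) : measurable A ->
  P ((fun w => (X w, - e w)) @^-1` A) = P ((fun w => (X w, e w)) @^-1` A).
Proof.
move=> mA.
have m1 : measurable_fun setT (fun w => (X w, - e w)).
  by apply: measurable_fun_pair => //; exact: measurableT_comp.
have m2 : measurable_fun setT (fun w => (X w, e w)) by exact: measurable_fun_pair.
pose mu1 := distribution P (mfun_Sub (mem_set m1)).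
pose mu2 := distribution P (mfun_Sub (mem_set m2)).
suff : mu1 A = mu2 A by [].
apply: (measure_unique
  [set C | exists2 B1, measurable B1 & exists2 B2, measurable B2 & C = B1 `*` B2]
  (fun=> setT)) => //.
- rewrite measurable_prod_measurableType; congr (<<s _ >>).
  by apply/seteqP; split=> [_ [B mB [C mC <-]]|_ [B mB [C mC ->]]];
    exists B => //; exists C.
- move=> _ _ [B mB [C mC ->]] [B' mB' [C' mC' ->]].
  exists (B `&` B'); first exact: measurableI.
  by exists (C `&` C'); [exact: measurableI|rewrite setXI].
- by move=> _; exists setT => //; exists setT => //; rewrite setXTT.
- by rewrite bigcup_const.
- move=> _ [B mB [C mC ->]].
  have mC' : measurable (-%R @^-1` C) by rewrite -[X in measurable X]setTI; exact: oppr_measurable.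
  have := eX mB mC; have := eX mB mC'.
  move=> E1 E2; apply: (etrans E1); apply: esym; apply: (etrans E2).
  by apply: eq_integral => w _; rewrite gaussian_symmetric.
- move=> _; apply: (le_lt_trans (probability_le1 _ _)) => //; exact: ltry.
Qed.

(** By [gaussian_dominated], the law of the error restricted to the event that [X] is in [D] is at
    most a multiple of one fixed Gaussian law; integrals then compare. *)
Lemma integral_error_le (eta : R) (D : set R) (h : R -> R) :
  0 < eta -> measurable D -> (forall x, D x -> eta <= s2 x <= eta^-1) ->
  measurable_fun setT h -> (forall x, 0 <= h x) ->
  (\int[P]_(w in X @^-1` D) (h (e w))%:E <=
   P (X @^-1` D) * (eta^-1%:E * \int[normal_prob 0 (Num.sqrt eta^-1)]_x (h x)%:E))%E.
Proof.
move=> eta0 mD s2D mh h0.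
have mXD : measurable (X @^-1` D) by rewrite -[X in measurable X]setTI; exact: measurable_funP.
have eta1 : 0 <= eta^-1 by rewrite invr_ge0 ltW.
pose p := fine (P (X @^-1` D)).
have p0 : 0 <= p by exact: fine_ge0.
have pE : P (X @^-1` D) = p%:E by rewrite /p fineK// fin_num_measure.
have pe0 : 0 <= p * eta^-1 by rewrite mulr_ge0.
pose k : {nonneg R} := NngNum pe0.
have me0 : measurable_fun setT (e : Omega -> R) by [].
have me : measurable_fun setT (e : Omega -> measurableTypeR R) by exact: me0.
pose m1 : {measure set (measurableTypeR R) -> \bar R} :=
  measure_function_pushforward__canonical__measure_function_Measure (mrestr P mXD) me.
pose m2 : {measure set (measurableTypeR R) -> \bar R} :=
  mscale k (normal_prob 0 (Num.sqrt eta^-1)).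
have m12 B : measurable B -> (m1 B <= m2 B)%E.
  move=> mB.
  have -> : m1 B = P (X @^-1` D `&` e @^-1` B) by rewrite setIC.
  rewrite eX//; set c := (normal_prob 0 (Num.sqrt eta^-1) B).
  have cfin : c \is a fin_num by rewrite fin_num_measure.
  have c0 : 0 <= fine c by apply: fine_ge0; exact: measure_ge0.
  have -> : m2 B = ((eta^-1 * fine c)%:E * P (X @^-1` D))%E.
    have -> : m2 B = ((p * eta^-1)%:E * c)%E by [].
    rewrite pE -[X in (_ * X)%E = _](fineK cfin) -!EFinM.
    by congr (_%:E); ring.
  apply: ge0_le_integral_cst => //; first exact: mulr_ge0.
    by move=> w _; exact: gaussian_ge0.
  move=> w Dw; rewrite EFinM fineK//; exact: gaussian_dominated (s2D _ Dw) mB.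
apply: (le_trans (ge0_integral_mrestr_ge P mXD _)).
  by move=> w; rewrite lee_fin.
have -> : (\int[mrestr P mXD]_x (h (e x))%:E = \int[m1]_y (h y)%:E)%E.
  rewrite ge0_integral_pushforward//=; first exact/measurable_EFinP.
  by move=> y _; rewrite lee_fin.
have H := @ge0_le_measure_integral _ _ _ m1 m2 m12 (EFin \o h) setT measurableT.
apply: (le_trans (H _ _)).
- by move=> y; rewrite lee_fin.
- exact/measurable_EFinP.
rewrite ge0_integral_mscale//=; last 2 first.
- by apply/measurable_EFinP.
- by move=> y _; rewrite lee_fin.
by rewrite pE muleA -EFinM.
Qed.

End conditional_gaussian.

(** * Second moments *)

Lemma measurable_set_bool d (T : measurableType d) (f : T -> bool) :
  measurable_fun setT f -> measurable [set w | f w].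
Proof.
move=> mf; rewrite (_ : mkset _ = setT `&` f @^-1` [set true]); first exact: mf.
by rewrite setTI.
Qed.

Section second_moment.
Context d (Omega : measurableType d) (R : realType) (P : probability Omega R).

Lemma independent_pair (I : finType) d' (T : measurableType d') (Z : I -> Omega -> T) i j :
  independent_family P Z -> i != j -> forall A B : set T, measurable A -> measurable B ->
  P (Z i @^-1` A `&` Z j @^-1` B) = (P (Z i @^-1` A) * P (Z j @^-1` B))%E.
Proof.
move=> iZ ij A B mA mB.
pose C k := if k == i then A else if k == j then B else setT.
have mC k : measurable (C k) by rewrite /C; case: ifP => // _; case: ifP.
have Ci : C i = A by rewrite /C eqxx.
have Cj : C j = B by rewrite /C eq_sym (negbTE ij) eqxx.
have := iZ C mC; rewrite (bigD1 i)//= (bigD1 j)/=; last by rewrite eq_sym.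
rewrite Ci Cj big1 ?mule1 => [<-|k /andP[ki kj]]; last first.
  by rewrite /C (negbTE ki) (negbTE kj) preimage_setT probability_setT.
congr (P _); apply/seteqP; split=> [w [Aw Bw] k _|w Cw].
  rewrite /C /preimage/=; case: eqP => [->//|_]; by case: eqP => [->|].
by split; [have := Cw i Logic.I|have := Cw j Logic.I]; rewrite /preimage/= ?Ci ?Cj.
Qed.

(** The joint law is the product measure, by uniqueness on rectangles; Tonelli's theorem does the
    rest. *)
Lemma integral_independentM d' (T : measurableType d') (Z1 Z2 : Omega -> T) (f g : T -> R) :
  measurable_fun setT Z1 -> measurable_fun setT Z2 ->
  (forall A B : set T, measurable A -> measurable B ->
    P (Z1 @^-1` A `&` Z2 @^-1` B) = (P (Z1 @^-1` A) * P (Z2 @^-1` B))%E) ->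
  measurable_fun setT f -> measurable_fun setT g ->
  (forall x, 0 <= f x) -> (forall x, 0 <= g x) ->
  (\int[P]_w (f (Z1 w) * g (Z2 w))%:E =
   (\int[P]_w (f (Z1 w))%:E) * (\int[P]_w (g (Z2 w))%:E))%E.
Proof.
move=> m1 m2 Zind mf mg f0 g0.
have m12 : measurable_fun setT (fun w => (Z1 w, Z2 w)) by exact: measurable_fun_pair.
pose mu1 := distribution P (mfun_Sub (mem_set m1)).
pose mu2 := distribution P (mfun_Sub (mem_set m2)).
pose mu := distribution P (mfun_Sub (mem_set m12)).
have mfg : measurable_fun setT (fun z : T * T => (f z.1 * g z.2)%:E).
  apply/measurable_EFinP; apply: measurable_funM.
    exact: (measurableT_comp mf measurable_fst).
  exact: (measurableT_comp mg measurable_snd).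
transitivity (\int[mu]_z (f z.1 * g z.2)%:E)%E.
  rewrite ge0_integral_distribution//.
  by move=> z; rewrite lee_fin mulr_ge0.
transitivity (\int[mu1 \x mu2]_z (f z.1 * g z.2)%:E)%E.
  apply: eq_measure_integral => A mA _.
  by apply/esym; apply: product_measure_unique => // B C mB mC; exact: Zind.
rewrite fubini_tonelli1//=; last by move=> z; rewrite lee_fin mulr_ge0.
rewrite /fubini_F /=.
have mfE : measurable_fun setT (EFin \o f) by exact/measurable_EFinP.
have mgE : measurable_fun setT (EFin \o g) by exact/measurable_EFinP.
under eq_integral.
  move=> x _.
  under eq_integral do rewrite EFinM.
  rewrite ge0_integralZl_EFin//; last by move=> y _; rewrite lee_fin.
  rewrite muleC.
  over.
rewrite /= ge0_integralZl//; last 2 first.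
- by move=> x _; rewrite lee_fin.
- by apply: integral_ge0 => x _; rewrite lee_fin.
rewrite muleC; congr (_ * _)%E.
  by rewrite ge0_integral_distribution// => x; rewrite lee_fin.
by rewrite ge0_integral_distribution// => x; rewrite lee_fin.
Qed.

Lemma markov_le (f : Omega -> R) (c a : R) :
  measurable_fun setT f -> (forall w, 0 <= f w) -> 0 < a ->
  (\int[P]_w (f w)%:E <= c%:E)%E -> (P [set w | (a <= f w)%R] <= (c / a)%:E)%E.
Proof.
move=> mf f0 a0 fc.
have mfE : measurable_fun setT (EFin \o f) by exact/measurable_EFinP.
have H := @le_integral_abse _ _ _ P setT measurableT _ _ mfE a0.
have E1 : [set w | (a <= f w)%R] = setT `&` [set w | (a%:E <= `|(EFin \o f) w|)%E].
  by rewrite setTI; apply/seteqP; split=> w /=; rewrite lee_fin ger0_norm.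
have E2 : (\int[P]_w `|(EFin \o f) w| = \int[P]_w (f w)%:E)%E.
  by apply: eq_integral => w _ /=; rewrite ger0_norm.
rewrite E1 EFinM lee_pdivlMr// muleC; apply: le_trans fc; by rewrite -E2.
Qed.

(* Adding [2 * M * W] to [(W - M) ^+ 2] keeps every integrand nonnegative, so no
   integrability needs to be checked. *)
Lemma chebyshev_sum (I : finType) (U : I -> Omega -> R) (m : I -> R) (b a : R) :
  (forall i, measurable_fun setT (U i)) -> (forall i w, 0 <= U i w) ->
  (forall i, (\int[P]_w (U i w)%:E = (m i)%:E)%E) ->
  (forall i, (\int[P]_w (U i w ^+ 2)%:E <= b%:E)%E) ->
  (forall i j, i != j -> (\int[P]_w (U i w * U j w)%:E = (m i * m j)%:E)%E) ->
  0 < a ->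
  (P [set w | (a <= `|\sum_i U i w - \sum_i m i|)%R] <= (#|I|%:R * b / a ^+ 2)%:E)%E.
Proof.
move=> mU U0 EU EU2 EUU a0.
set W := fun w => \sum_i U i w; set M := \sum_i m i.
have mW : measurable_fun setT W by exact: measurable_sum.
have W0 w : 0 <= W w by exact: sumr_ge0.
have m0 i : 0 <= m i.
  by rewrite -lee_fin -EU; apply: integral_ge0 => w _; rewrite lee_fin.
have M0 : 0 <= M by exact: sumr_ge0.
have EW : (\int[P]_w (W w)%:E = M%:E)%E.
  rewrite /W; under eq_integral do rewrite -sumEFin.
  rewrite ge0_integral_sum//; last 2 first.
  - by move=> i; exact/measurable_EFinP.
  - by move=> i w _; rewrite lee_fin.
  by under eq_bigr do rewrite EU; rewrite sumEFin.
have EW2 : (\int[P]_w (W w ^+ 2)%:E <= (M ^+ 2 + #|I|%:R * b)%:E)%E.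
  have -> : (\int[P]_w (W w ^+ 2)%:E = \sum_i \sum_j \int[P]_w (U i w * U j w)%:E)%E.
    under eq_integral.
      move=> w _; rewrite /W expr2 mulr_suml -sumEFin.
      under eq_bigr do rewrite mulr_sumr -sumEFin.
      over.
    rewrite ge0_integral_sum//; last 2 first.
    - move=> i; apply: emeasurable_sum => j; apply/measurable_EFinP; exact: measurable_funM.
    - by move=> i w _; apply: sume_ge0 => j _; rewrite lee_fin mulr_ge0.
    apply: eq_bigr => i _; rewrite ge0_integral_sum//.
    - by move=> j; apply/measurable_EFinP; exact: measurable_funM.
    - by move=> j w _; rewrite lee_fin mulr_ge0.
  have -> : M ^+ 2 + #|I|%:R * b = \sum_i (\sum_j m i * m j + b).
    rewrite big_split/= sumr_const mulr_natl; congr (_ + _).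
    by rewrite expr2 mulr_suml; apply: eq_bigr => i _; rewrite mulr_sumr.
  rewrite -sumEFin; apply: lee_sum => i _.
  (* The diagonal contributes at most [b] per index; adding the nonnegative [m i * m i] completes
     the square of [M]. *)
  rewrite (bigD1 i)//= [in leRHS](bigD1 i)//= EFinD.
  apply: (@le_trans _ _ (b%:E + \sum_(j | j != i) (m i * m j)%:E)%E).
    apply: leeD; first exact: EU2.
    by apply: lee_sum => j ji; rewrite EUU// eq_sym.
  rewrite sumEFin -!EFinD lee_fin.
  by have := mulr_ge0 (m0 i) (m0 i); lra.
have mWM : measurable_fun setT (fun w => (W w - M) ^+ 2).
  by apply: measurable_funX; exact: measurable_funB.
have EV : (\int[P]_w ((W w - M) ^+ 2)%:E <= (#|I|%:R * b)%:E)%E.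
  have E1 : (\int[P]_w ((W w - M) ^+ 2)%:E + (2 * M ^+ 2)%:E =
             \int[P]_w (W w ^+ 2)%:E + (M ^+ 2)%:E)%E.
    have -> : (2 * M ^+ 2)%:E = (\int[P]_w (2 * M * W w)%:E)%E.
      under eq_integral do rewrite EFinM.
      rewrite ge0_integralZl_EFin// ?mulr_ge0// ?EW; last 2 first.
      - by move=> w _; rewrite lee_fin.
      - exact/measurable_EFinP.
      by rewrite -EFinM expr2 mulrA.
    have -> : (M ^+ 2)%:E = (\int[P]_w (M ^+ 2)%:E)%E.
      by rewrite integral_cst//= probability_setT mule1.
    rewrite -!ge0_integralD//.
    - by apply: eq_integral => w _; rewrite -!EFinD; congr (_%:E); ring.
    - by move=> w _; rewrite lee_fin sqr_ge0.
    - by apply/measurable_EFinP; exact: measurable_funX.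
    - by move=> w _; rewrite lee_fin sqr_ge0.
    - by move=> w _; rewrite lee_fin sqr_ge0.
    - exact/measurable_EFinP.
    - by move=> w _; rewrite lee_fin !mulr_ge0.
    - by apply/measurable_EFinP; exact: measurable_funM.
  have : (\int[P]_w ((W w - M) ^+ 2)%:E + (2 * M ^+ 2)%:E <=
          (M ^+ 2 + #|I|%:R * b)%:E + (M ^+ 2)%:E)%E.
    by rewrite E1 leeD2r.
  rewrite -leeBrDr// => /le_trans; apply.
  by rewrite -EFinD lee_fin; lra.
have -> : [set w | (a <= `|\sum_i U i w - M|)%R] = [set w | (a ^+ 2 <= (W w - M) ^+ 2)%R].
  apply/seteqP; split=> w /=; rewrite -/(W w) -[(W w - M) ^+ 2](real_normK (num_real _));
    by rewrite ler_sqr ?nnegrE// ltW.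
by apply: markov_le => //; [move=> w; exact: sqr_ge0 | rewrite exprn_gt0].
Qed.

End second_moment.

(** * Local sums *)

Definition near_term (R : realType) (h : R -> R) (r x y : R) : R :=
  if `|x| < r then h y else 0.

(** Three choices of [h] are used: 1 counts points, the square gives the energy in the Rademacher
    tail, the absolute value gives a crude bound near 0. *)
Definition near_sum (R : realType) n (h : R -> R) (x y : 'I_n -> R) (r : R) : R :=
  \sum_i near_term h r (x i) (y i).

Section sample.
Context (R : realType) (F s2 : R -> R) (eta : R).
Hypothesis s2_ge0 : forall x, 0 <= s2 x.
Hypothesis eta_gt0 : 0 < eta.
Hypothesis F_eta : forall t, 0 < t < eta -> eta * t <= `|F t - F (- t)| <= t / eta.
Hypothesis s2_eta : forall x, `|x| < eta -> eta <= s2 x <= eta^-1.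
Context d (Omega : measurableType d) (P : probability Omega R) (n : nat).
Variables (X e : 'I_n -> {RV P >-> R}).
Hypothesis sample : regression_sample F s2 X e.

Let Z i w := (X i w, e i w).
Let mXball (r : R) i : measurable (X i @^-1` [set x : R | (`|x| < r)%R]).
Proof. by apply: measurable_set_bool; apply: measurable_fun_ltr => //; exact: measurableT_comp. Qed.


Let mZ i : measurable_fun setT (Z i).
Proof. exact: measurable_fun_pair. Qed.

Lemma measurable_near_ball (r : R) : measurable [set x : R | `|x| < r].
Proof.
apply: measurable_set_bool; apply: measurable_fun_ltr => //.
Qed.

Let mnear h r : measurable_fun setT h -> measurable_fun setT (fun z : R * R => near_term h r z.1 z.2).
Proof.
move=> mh; apply: measurable_fun_ifT => //.
- apply: measurable_fun_ltr => //; apply: measurableT_comp => //; exact: measurable_fst.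
- exact: (measurableT_comp mh measurable_snd).
Qed.

Lemma measurable_near_sum (h : R -> R) (r : R) : measurable_fun setT h ->
  measurable_fun setT (fun w => near_sum h (X^~ w) (e^~ w) r).
Proof.
move=> mh; apply: measurable_sum => i.
exact: (measurableT_comp (mnear r mh) (@mZ i)).
Qed.

Lemma prob_itvoc i (a b : R) : a <= b ->
  P (X i @^-1` `]a, b]) = (F b - F a)%:E.
Proof.
move=> ab; have [Fc _ _] := sample.
have mX r : measurable (X i @^-1` `]-oo, r]) by exact: measurable_sfunP.
have -> : `]a, b]%classic = `]-oo, b] `\` `]-oo, a] :> set R.
  apply/seteqP; split=> x /=; rewrite !in_itv/=.
    by move=> /andP[ax xb]; split=> //; apply/negP; rewrite -ltNge.
  by move=> [xb /negP]; rewrite -ltNge => ax; exact/andP.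
rewrite (_ : _ @^-1` (_ `\` _) = X i @^-1` `]-oo, b] `\` X i @^-1` `]-oo, a])// measureD//; last by rewrite ltey_eq fin_num_measure.
rewrite setIidr; last first.
  by move=> w /=; rewrite !in_itv/= => /le_trans; apply.
have Fc' r : P (X i @^-1` `]-oo, r]) = (F r)%:E by exact: Fc.
rewrite EFinB; congr (_ - _)%E; exact: Fc'.
Qed.

Lemma prob_near_le i (r : R) : 0 < r ->
  (P (X i @^-1` [set x : R | (`|x| < r)%R]) <= (r / eta)%:E)%E.
Proof.
move=> r0; have [etar|reta] := leP eta r.
  apply: (le_trans (probability_le1 _ _))=> //.
  by rewrite lee_fin ler_pdivlMr// mul1r.
have /andP[_ h] := F_eta (introT andP (conj r0 reta)).
have rr : - r <= r by lra.
apply: (@le_trans _ _ (P (X i @^-1` `]- r, r]))).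
  rewrite le_measure ?inE//.
  - exact: measurable_sfunP.
  - by move=> w /=; rewrite in_itv/= ltr_norml => /andP[-> /ltW ->].
rewrite prob_itvoc// lee_fin; exact: le_trans (ler_norm _) h.
Qed.

(** The half-open interval of radius [r / 2] lies in the ball, and [r / 2 < eta] even when
    [r = eta]; this costs a factor 2. *)
Lemma prob_near_ge i (r : R) : 0 < r <= eta ->
  ((eta * r / 2)%:E <= P (X i @^-1` [set x : R | (`|x| < r)%R]))%E.
Proof.
move=> /andP[r0 reta].
have r2 : 0 < r / 2 < eta by apply/andP; split; lra.
have /andP[h _] := F_eta r2.
have rr : - (r / 2) <= r / 2 by lra.
apply: (@le_trans _ _ (P (X i @^-1` `]- (r / 2), r / 2]))).
  have F0 : 0 <= F (r / 2) - F (- (r / 2)) by rewrite -lee_fin -(prob_itvoc i rr).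
  by rewrite prob_itvoc// lee_fin -mulrA; rewrite ger0_norm in h.
rewrite le_measure ?inE//; first exact: measurable_sfunP.
by move=> w /=; rewrite in_itv/= ltr_norml => /andP[? ?]; apply/andP; split; lra.
Qed.

Let integral_near h r i : (\int[P]_w (near_term h r (X i w) (e i w))%:E =
  \int[P]_(w in X i @^-1` [set x : R | (`|x| < r)%R]) (h (e i w))%:E)%E.
Proof.
rewrite [RHS]integral_mkcond; apply: eq_integral => w _.
rewrite /near_term /patch/=; case: ifPn => [wr|wr]; first by rewrite mem_set.
by rewrite memNset//; exact/negP.
Qed.

Lemma near_sum_deviation (h : R -> R) (r b a : R) : measurable_fun setT h -> (forall x, 0 <= h x) ->
  (forall i, (\int[P]_w (near_term h r (X i w) (e i w))%:E < +oo)%E) ->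
  (forall i, (\int[P]_w (near_term (fun x => h x ^+ 2) r (X i w) (e i w))%:E <= b%:E)%E) ->
  0 < a ->
  (P [set w | (a <= `|near_sum h (X^~ w) (e^~ w) r -
      \sum_i fine (\int[P]_w (near_term h r (X i w) (e i w))%:E)|)%R] <= (n%:R * b / a ^+ 2)%:E)%E.
Proof.
move=> mh h0 hfin hb a0.
have [_ _ iZ] := sample.
have near0 x y : 0 <= near_term h r x y by rewrite /near_term; case: ifP.
have := @chebyshev_sum _ _ _ P 'I_n (fun i w => near_term h r (X i w) (e i w))
  (fun i => fine (\int[P]_w (near_term h r (X i w) (e i w))%:E)) b a.
rewrite card_ord; apply => //.
- by move=> i; exact: (measurableT_comp (mnear r mh) (@mZ i)).
- move=> i /=; rewrite fineK// ge0_fin_numE//.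
  by apply: integral_ge0 => w _; rewrite lee_fin.
- move=> i; apply: le_trans (hb i); rewrite le_eqVlt; apply/orP; left; apply/eqP.
  by apply: eq_integral => w _; rewrite /near_term; case: ifP => // _; rewrite expr0n.
- move=> i j ij /=; rewrite EFinM !fineK.
  + apply: (integral_independentM (Z1 := Z i) (Z2 := Z j) (f := fun z : R * R => near_term h r z.1 z.2)
      (g := fun z : R * R => near_term h r z.1 z.2)) => //; try exact: mnear.
    by move=> A B mA mB; exact: (independent_pair iZ ij).
  + by rewrite ge0_fin_numE//; apply: integral_ge0 => w _; rewrite lee_fin.
  + by rewrite ge0_fin_numE//; apply: integral_ge0 => w _; rewrite lee_fin.
Qed.


(** The mean count is at least [n * eta * r / 2], so a count below half of that deviates by
    [n * eta * r / 4]; the second moment of each indicator is at most [r / eta]. *)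
Lemma near_count_small (r : R) : (0 < n)%N -> 0 < r <= eta ->
  (P [set w | (near_sum (fun=> 1) (X^~ w) (e^~ w) r <= n%:R * (eta * r / 4))%R] <=
   (16 / (eta ^+ 3 * (n%:R * r)))%:E)%E.
Proof.
move=> n0 /andP[r0 re].
have nR0 : 0 < n%:R :> R by rewrite ltr0n.
have E1 i : (\int[P]_w (near_term (fun=> 1) r (X i w) (e i w))%:E =
    P (X i @^-1` [set x : R | (`|x| < r)%R]))%E.
  by rewrite integral_near integral_cst// mul1e.
have a0 : 0 < n%:R * (eta * r / 4) by rewrite mulr_gt0// divr_gt0// mulr_gt0.
have := @near_sum_deviation (fun=> 1) r (r / eta) _ _ (fun=> ler01) _ _ a0.
move=> /(_ (measurable_cst _)) H.
apply: le_trans (le_trans (H _ _) _).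
- rewrite le_measure ?inE//.
  + by apply: measurable_set_bool; apply: measurable_fun_ler => //; exact: measurable_near_sum.
  + apply: measurable_set_bool; apply: measurable_fun_ler => //.
    apply: measurableT_comp => //; apply: measurable_funB => //; exact: measurable_near_sum.
  + move=> w /= hw; rewrite ler_normr; apply/orP; right.
    have : n%:R * (eta * r / 2) <=
        \sum_i fine (\int[P]_w (near_term (fun=> 1) r (X i w) (e i w))%:E).
      rewrite -[n in n%:R]card_ord -sumr_const mulr_suml; apply: ler_sum => i _.
      rewrite mul1r -lee_fin E1 fineK ?fin_num_measure//; apply: prob_near_ge.
      by rewrite r0.
    by move: hw; rewrite /cst; lra.
- by move=> i; rewrite E1 ltey_eq fin_num_measure.
- move=> i; apply: le_trans (prob_near_le i r0); rewrite -E1 le_eqVlt; apply/orP; left; apply/eqP.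
  by apply: eq_integral => w _; rewrite /near_term expr1n.
rewrite lee_fin le_eqVlt; apply/orP; left; apply/eqP; field.
by rewrite !gt_eqF.
Qed.

Section error_moments.
Variable M : R.
Hypothesis M_gt0 : 0 < M.
Hypothesis normal_moment_le :
  (\int[normal_prob 0 (Num.sqrt eta^-1)]_x (1 + x ^+ 4)%:E <= M%:E)%E.

Lemma integral_near_term_le i (h : R -> R) (r : R) : 0 < r <= eta -> measurable_fun setT h ->
  (forall x, 0 <= h x <= 1 + x ^+ 4) ->
  (\int[P]_w (near_term h r (X i w) (e i w))%:E <= (M / eta ^+ 2 * r)%:E)%E.
Proof.
move=> /andP[r0 re] mh h01; have [_ eX _] := sample.
have h0 x : 0 <= h x by have /andP[] := h01 x.
rewrite integral_near.
apply: (le_trans (integral_error_le (eX i) eta_gt0 (measurable_near_ball r) _ mh h0)).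
  by move=> x /= xr; apply: s2_eta; exact: lt_le_trans xr re.
have hM : (\int[normal_prob 0 (Num.sqrt eta^-1)]_x (h x)%:E <= M%:E)%E.
  apply: le_trans normal_moment_le; apply: ge0_le_integral => //.
  - by move=> x _; rewrite lee_fin.
  - by apply/measurable_EFinP.
  - apply/measurable_EFinP; apply: measurable_funD => //; exact: exprn_measurable.
  - by move=> x _; rewrite lee_fin; have /andP[] := h01 x.
have -> : M / eta ^+ 2 * r = (r / eta) * (eta^-1 * M) by field; rewrite gt_eqF.
rewrite EFinM; apply: lee_pmul => //.
- rewrite mule_ge0 ?lee_fin ?invr_ge0 ?(ltW eta_gt0)//.
  by apply: integral_ge0 => x _; rewrite lee_fin.
- exact: prob_near_le.
- by rewrite EFinM lee_pmul2l ?lte_fin ?invr_gt0.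
Qed.

(** The threshold is twice a bound on the mean, and fourth moments control the variance. The ball
    may be truncated at [eta] while the bounds keep the nominal radius [t]. *)
Lemma near_energy_large (r t : R) : (0 < n)%N -> 0 < r <= eta -> r <= t ->
  (P [set w | (2 * (M / eta ^+ 2) * (n%:R * t) <=
       near_sum (fun y => y ^+ 2) (X^~ w) (e^~ w) r)%R] <=
   (M / eta ^+ 2 * (n%:R * t))^-1%:E)%E.
Proof.
move=> n0 rr rt; have /andP[r0 re] := rr.
have t0 : 0 < t by exact: lt_le_trans rt.
have nR0 : 0 < n%:R :> R by rewrite ltr0n.
set k := M / eta ^+ 2.
have k0 : 0 < k by rewrite divr_gt0// exprn_gt0.
have a0 : 0 < k * (n%:R * t) by rewrite mulr_gt0// mulr_gt0.
have sq0 (x : R) : 0 <= x ^+ 2 by exact: sqr_ge0.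
have mean_le i : (\int[P]_w (near_term (fun y : R => (y ^+ 2)%R) r (X i w) (e i w))%:E <= (k * t)%:E)%E.
  apply: (@le_trans _ _ (k * r)%:E); last by rewrite lee_fin ler_pM2l.
  apply: integral_near_term_le => //.
  move=> x; rewrite sq0/=; have := sqr_ge0 (x ^+ 2 - 1); rewrite (exprM x 2 2).
  by have := sq0 x; nra.
have := @near_sum_deviation (fun y => y ^+ 2) r (k * t) _ (exprn_measurable _) sq0 _ _ a0.
move=> H.
apply: le_trans (le_trans (H _ _) _).
- rewrite le_measure ?inE//.
  + apply: measurable_set_bool; apply: measurable_fun_ler => //.
    by apply: measurable_near_sum; exact: exprn_measurable.
  + apply: measurable_set_bool; apply: measurable_fun_ler => //.
    apply: measurableT_comp => //; apply: measurable_funB => //.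
    by apply: measurable_near_sum; exact: exprn_measurable.
  + move=> w /= hw; rewrite ler_normr; apply/orP; left.
    have : \sum_i fine (\int[P]_w (near_term (fun y : R => (y ^+ 2)%R) r (X i w) (e i w))%:E) <=
        n%:R * (k * t).
      rewrite -[n in n%:R]card_ord -sumr_const mulr_suml; apply: ler_sum => i _.
      rewrite mul1r -lee_fin fineK// ge0_fin_numE; first exact: le_lt_trans (mean_le i) (ltry _).
      by apply: integral_ge0 => w' _; rewrite lee_fin /near_term; case: ifP.
    by move: hw; lra.
- by move=> i; exact: le_lt_trans (mean_le i) (ltry _).
- move=> i; apply: (@le_trans _ _ (k * r)%:E); last by rewrite lee_fin ler_pM2l.
  apply: integral_near_term_le => //.
    by apply: measurable_funX; exact: exprn_measurable.
  by move=> x; rewrite sqr_ge0/= -exprM lerDr.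
rewrite lee_fin le_eqVlt; apply/orP; left; apply/eqP; field.
by rewrite !gt_eqF.
Qed.

(** Markov's inequality, meant for the innermost ball, where the mean number of points stays
    bounded. *)
Lemma near_abs_large (r a : R) : 0 < r <= eta -> 0 < a ->
  (P [set w | (a <= near_sum Num.norm (X^~ w) (e^~ w) r)%R] <=
   (M / eta ^+ 2 * (n%:R * r) / a)%:E)%E.
Proof.
move=> rr a0.
have mabs : measurable_fun setT (Num.norm : R -> R) by [].
apply: markov_le => //; first exact: measurable_near_sum.
  by move=> w; apply: sumr_ge0 => i _; rewrite /near_term; case: ifP.
rewrite /near_sum; under eq_integral do rewrite -sumEFin.
rewrite ge0_integral_sum//; last 2 first.
- by move=> i; apply/measurable_EFinP; exact: (measurableT_comp (mnear r mabs) (@mZ i)).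
- by move=> i w _; rewrite lee_fin /near_term; case: ifP.
have -> : M / eta ^+ 2 * (n%:R * r) = \sum_(i < n) M / eta ^+ 2 * r.
  by rewrite sumr_const card_ord -mulr_natl; ring.
rewrite -sumEFin; apply: lee_sum => i _; apply: integral_near_term_le => //.
move=> x; rewrite normr_ge0/=.
have -> : x ^+ 4 = `|x| ^+ 4 by rewrite -[RHS]normrX ger0_norm// exprn_even_ge0.
rewrite (exprM _ 2 2); have := normr_ge0 x; move: `|x| => y y0.
by have := sqr_ge0 (y ^+ 2 - 1); have := sqr_ge0 (y - 1); nra.
Qed.

End error_moments.

End sample.

(** * Maximal prefix sums *)

Definition excursion (R : realType) n (x y : 'I_n -> R) (r lam : R) : bool :=
  [exists j, (`|x j| < r) && (lam < `|\sum_(i | `|x i| <= `|x j|) y i|)].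

Section excursion_measurable.
Context d (T : measurableType d) (R : realType) (n : nat).
Variables (x y : 'I_n -> T -> R).
Hypothesis mx : forall i, measurable_fun setT (x i).
Hypothesis my : forall i, measurable_fun setT (y i).

Let mnorm i : measurable_fun setT (fun w => `|x i w|).
Proof. exact: measurableT_comp. Qed.

Lemma measurable_prefix_sum j :
  measurable_fun setT (fun w => \sum_(i | `|x i w| <= `|x j w|) y i w).
Proof.
under eq_fun do rewrite big_mkcond/=.
apply: measurable_sum => i; apply: measurable_fun_ifT => //.
exact: measurable_fun_ler.
Qed.

Lemma measurable_excursion (r lam : R) :
  measurable [set w | excursion (x^~ w) (y^~ w) r lam].
Proof.
rewrite (_ : mkset _ = \bigcup_(j in [set: 'I_n])
    [set w | (`|x j w| < r) && (lam < `|\sum_(i | `|x i w| <= `|x j w|) y i w|)]).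
  apply: fin_bigcup_measurable => // j _; apply: measurable_set_bool.
  apply: measurable_and; apply: measurable_fun_ltr => //.
  by apply: measurableT_comp => //; exact: measurable_prefix_sum.
apply/seteqP; split=> w /=.
  by move=> /existsP[j hj]; exists j.
by move=> [j _ hj]; apply/existsP; exists j.
Qed.

Lemma measurable_near_sum_comp (h : R -> R) (r : R) : measurable_fun setT h ->
  measurable_fun setT (fun w => near_sum h (x^~ w) (y^~ w) r).
Proof.
move=> mh; apply: measurable_sum => i; apply: measurable_fun_ifT => //.
  exact: measurable_fun_ltr.
exact: measurableT_comp.
Qed.

End excursion_measurable.

(** A prefix ending inside the ball involves only points of the ball, so the coefficients outside
    may be set to 0 and the maximal inequality applied with the energy of the ball. *)
Lemma excursion_count (R : realType) n (x y : 'I_n -> R) (r lam v : R) :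
  0 < v -> 0 <= lam -> near_sum (fun u => u ^+ 2) x y r <= v ->
  #|[pred s : {ffun 'I_n -> bool} | excursion x (fun i => (-1) ^+ s i * y i) r lam]|%:R <=
  2 ^+ n * (4 * expR (- (lam ^+ 2 / (8 * v)))).
Proof.
move=> v0 lam0 hv.
pose a i := near_term id r (x i) (y i).
have av : \sum_i a i ^+ 2 <= v.
  apply: le_trans hv; rewrite le_eqVlt; apply/orP; left; apply/eqP.
  by apply: eq_bigr => i _; rewrite /a /near_term; case: ifP; rewrite // expr0n.
have := rademacher_maximal (fun i => `|x i|) v0 lam0 av.
rewrite card_ord; apply: le_trans; rewrite ler_nat; apply: subset_leq_card.
apply/fintype.subsetP => s; rewrite !inE => /existsP[j /andP[jr hj]].
apply/existsP; exists j; apply: (lt_le_trans hj).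
rewrite le_eqVlt; apply/orP; left; apply/eqP; congr (`|_|).
by apply: eq_bigr => i ij; rewrite /a /near_term (le_lt_trans ij jr).
Qed.

Section excursion_prob.
Context (R : realType) (F s2 : R -> R).
Hypothesis s2_ge0 : forall x, 0 <= s2 x.
Context d (Omega : measurableType d) (P : probability Omega R) (n : nat).
Variables (X e : 'I_n -> {RV P >-> R}).
Hypothesis sample : regression_sample F s2 X e.

(* The law of the sample is invariant under flipping the signs of the errors;
   averaging over all sign patterns reduces the bound to Rademacher sums with
   fixed coefficients. *)
Lemma excursion_prob (r lam v : R) : 0 < v -> 0 <= lam ->
  (P [set w | excursion (X^~ w) (e^~ w) r lam &&
       (near_sum (fun u => u ^+ 2) (X^~ w) (e^~ w) r <= v)%R] <=
   (4 * expR (- (lam ^+ 2 / (8 * v))))%:E)%E.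
Proof.
move=> v0 lam0; have [_ eX iZ] := sample.
pose good (x y : 'I_n -> R) := excursion x y r lam && (near_sum (fun u => u ^+ 2) x y r <= v).
pose E : set (n.-tuple (R * R)) :=
  [set z | good (fun i => (tnth z i).1) (fun i => (tnth z i).2)].
have mgood d' (T : measurableType d') (x y : 'I_n -> T -> R) :
    (forall i, measurable_fun setT (x i)) -> (forall i, measurable_fun setT (y i)) ->
    measurable [set w | good (x^~ w) (y^~ w)].
  move=> mx my.
  rewrite (_ : mkset _ = [set w | excursion (x^~ w) (y^~ w) r lam] `&`
      [set w | near_sum (fun u => u ^+ 2) (x^~ w) (y^~ w) r <= v]).
    apply: measurableI; first exact: measurable_excursion.
    apply: measurable_set_bool; apply: measurable_fun_ler => //.
    by apply: measurable_near_sum_comp => //; exact: exprn_measurable.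
  by apply/seteqP; split=> w /= => [/andP[]|[h1 h2]]; rewrite /good ?h1.
have mE : measurable E.
  apply: mgood => i.
    exact: (measurableT_comp measurable_fst (measurable_tnth i)).
  exact: (measurableT_comp measurable_snd (measurable_tnth i)).
pose Z (i : 'I_n) w := (X i w, e i w).
pose sgn (s : {ffun 'I_n -> bool}) (i : 'I_n) (z : R * R) := (z.1, (-1) ^+ s i * z.2).
have mZ i : measurable_fun setT (Z i) by exact: measurable_fun_pair.
have msgn s i : measurable_fun setT (sgn s i).
  apply: measurable_fun_pair; first exact: measurable_fst.
  by apply: measurable_funM => //; exact: measurable_snd.
pose G (s : {ffun 'I_n -> bool}) := [set w | good (X^~ w) (fun i => (-1) ^+ s i * e i w)].
have mG s : measurable (G s).
  by apply: mgood => // i; exact: measurable_funM.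
pose p := P [set w | good (X^~ w) (e^~ w)].
have PG s : P (G s) = p.
  have E1 (W : 'I_n -> Omega -> R * R) : (fun w => [tuple W i w | i < n]) @^-1` E =
     [set w | good (fun i => (W i w).1) (fun i => (W i w).2)].
    apply/seteqP; split=> w; rewrite /E /preimage/=.
      by under [X in good X _]eq_fun do rewrite tnth_mktuple;
         under [X in good _ X]eq_fun do rewrite tnth_mktuple.
    by under [X in _ -> good X _]eq_fun do rewrite tnth_mktuple;
       under [X in _ -> good _ X]eq_fun do rewrite tnth_mktuple.
  have mZ' i : measurable_fun setT (fun w => sgn s i (Z i w)).
    exact: (measurableT_comp (msgn s i) (mZ i)).
  have iZ' := independent_family_comp (msgn s) iZ.
  have marg i (A : set (R * R)) : measurable A ->
      P (Z i @^-1` A) = P ((fun w => sgn s i (Z i w)) @^-1` A).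
    move=> mA; rewrite /sgn; case: (s i) => /=.
      rewrite -(flip_error_law s2_ge0 (eX i) mA); congr (P _).
      by apply/seteqP; split=> w /=; rewrite expr1 mulN1r.
    by congr (P _); apply/seteqP; split=> w /=; rewrite expr0 mul1r.
  by have := independent_law_eq mZ mZ' iZ iZ' marg mE; rewrite !E1 => <-.
have pfin : p \is a fin_num by rewrite fin_num_measure//; exact: mgood.
pose c := 4 * expR (- (lam ^+ 2 / (8 * v))).
have c0 : 0 <= c by rewrite mulr_ge0 ?expR_ge0.
rewrite -/p -/c.
(* The sum is the mean number of good sign patterns, which [excursion_count] bounds pointwise. *)
have : (\sum_(s : {ffun 'I_n -> bool}) P (G s) <= (2 ^+ n * c)%:E)%E.
  have -> : (\sum_(s : {ffun 'I_n -> bool}) P (G s) =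
     \int[P]_w (\sum_(s : {ffun 'I_n -> bool}) (\1_(G s) w)%:E))%E.
    rewrite ge0_integral_sum//; last first.
      by move=> s; apply/measurable_EFinP; exact: measurable_indic.
    by apply: eq_bigr => s _; rewrite integral_indic// setIT.
  apply: (@le_trans _ _ (\int[P]_w (2 ^+ n * c)%:E)%E).
    apply: ge0_le_integral => //.
    - by move=> w _; apply: sume_ge0 => s _; rewrite lee_fin.
    - by apply: emeasurable_sum => s; apply/measurable_EFinP; exact: measurable_indic.
    move=> w _; rewrite sumEFin lee_fin.
    have [hv|hv] := boolP (near_sum (fun u => u ^+ 2) (X^~ w) (e^~ w) r <= v).
      apply: le_trans (excursion_count v0 lam0 hv).
      rewrite -sum1_card natr_sum [leRHS]big_mkcond/=; apply: ler_sum => s _.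
      rewrite indicE; case: (boolP (w \in G s)) => [|_]; last by case: ifP.
      by rewrite inE => /andP[h _]; rewrite inE h.
    (* With too much energy no pattern is good, since flips preserve the squares. *)
    rewrite big1 ?mulr_ge0 ?exprn_ge0// => s _.
    rewrite indicE memNset// => /andP[_]; apply/negP; move: hv; congr (~~ (_ <= v)).
    apply: eq_bigr => i _; rewrite /near_term; case: ifP => // _.
    by rewrite exprMn sqrr_sign mul1r.
  by rewrite integral_cst//= probability_setT mule1.
under eq_bigr do rewrite PG.
rewrite -(fineK pfin) sumEFin sumr_const card_ffun card_bool card_ord.
rewrite !lee_fin.
by rewrite -[fine p *+ _]mulr_natl natrX ler_pM2l// exprn_gt0.
Qed.

End excursion_prob.

(** * The test statistic *)

Section order_statistics.
Context {R : realType} {n : nat}.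
Implicit Types (x y : 'I_n -> R) (k : nat).

Definition near_count x (r : R) : nat := #|[pred i | `|x i| < r]|.

Lemma near_countE x y r : (near_count x r)%:R = near_sum (fun=> 1) x y r.
Proof.
by rewrite /near_count -sum1_card natr_sum big_mkcond; apply: eq_bigr => i _;
  rewrite /near_term inE.
Qed.

Lemma near_count_le x (r r' : R) : r <= r' -> (near_count x r <= near_count x r')%N.
Proof.
move=> rr'; apply: subset_leq_card; apply/fintype.subsetP => i; rewrite !inE.
by move=> /lt_le_trans; apply.
Qed.

Lemma near_count_max x (r : R) : (near_count x r <= n)%N.
Proof. by rewrite -[leqRHS]card_ord max_card. Qed.

(** Trades the sorted list, whose positions start at 0, for a count, through which ties and
    measurability are handled. *)
Lemma kth_least_abs_lt x k (r : R) : (0 < k <= n)%N ->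
  (kth_least_abs x k < r) = (k <= near_count x r)%N.
Proof.
move=> /andP[k0 kn]; rewrite /kth_least_abs; set s := sort _ _.
have ss : sorted <=%R s by exact: sort_le_sorted.
have szs : size s = n by rewrite size_sort size_map size_enum_ord.
have cs : near_count x r = count (fun u => u < r) s.
  rewrite (seq.permP (permEl (perm_sort _ _))) count_map -size_filter enumT.
  rewrite /near_count cardE /enum_mem.
  by congr size; apply: eq_filter => i; rewrite inE.
apply/idP/idP => h; last by rewrite nth_count_lt// -cs prednK.
rewrite leqNgt; apply/negP => kc; move: h; rewrite ltNge => /negP; apply.
by rewrite nth_count_ge// szs -cs -ltnS !prednK// kc.
Qed.

Lemma kth_least_abs_mem x k : (0 < k <= n)%N -> exists j, kth_least_abs x k = `|x j|.
Proof.
move=> /andP[k0 kn].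
have : kth_least_abs x k \in [seq `|x i| | i <- enum 'I_n].
  rewrite /kth_least_abs -(mem_sort <=%R) mem_nth//.
  by rewrite size_sort size_map size_enum_ord prednK.
by move=> /mapP[j _ ->]; exists j.
Qed.

(** A form free of sorting, built from counts only, from which measurability follows. *)
Lemma nn_estimatorE (eta : R) x y k : (0 < k <= n)%N ->
  nn_estimator eta x y k =
  if (k <= near_count x eta)%N then
    k%:R^-1 * \sum_j (if (near_count x `|x j| < k)%N then y j else 0) else 0.
Proof.
move=> kn; rewrite /nn_estimator kth_least_abs_lt//; case: ifP => // _.
congr (_ * _); rewrite big_mkcond/=; apply: eq_bigr => j _.
by rewrite leNgt kth_least_abs_lt// -ltnNge.
Qed.

Lemma le_nn_estimator (eta : R) x y y' k : (forall i, y i <= y' i) ->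
  nn_estimator eta x y k <= nn_estimator eta x y' k.
Proof.
move=> yy'; rewrite /nn_estimator; case: ifP => // _.
by rewrite ler_wpM2l ?invr_ge0// ler_sum.
Qed.

Lemma max_statistic_ge (eta : R) x y k : (0 < k <= n)%N ->
  Num.sqrt k%:R * nn_estimator eta x y k <= max_statistic eta x y.
Proof.
move=> kn; rewrite /max_statistic.
have : k \in index_iota 1 n.+1 by rewrite mem_index_iota ltnS.
elim: (index_iota 1 n.+1) => // j s IHs; rewrite inE big_cons le_max => /orP[/eqP <-|/IHs ->].
  by rewrite lexx.
by rewrite orbT.
Qed.

Lemma max_statistic_le (eta : R) x y (B : R) : (0 < n)%N ->
  (forall k, (0 < k <= n)%N -> Num.sqrt k%:R * nn_estimator eta x y k <= B) ->
  max_statistic eta x y <= B.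
Proof.
move=> n0 hB; rewrite /max_statistic big_seq.
elim/big_ind : _ => [|u v uB vB|k].
- by apply: hB; rewrite n0.
- by rewrite ge_max uB.
- by rewrite mem_index_iota ltnS => /hB.
Qed.

Lemma le_max_statistic (eta : R) x y y' : (0 < n)%N -> (forall i, y i <= y' i) ->
  max_statistic eta x y <= max_statistic eta x y'.
Proof.
move=> n0 yy'; apply: max_statistic_le => // k kn.
apply: le_trans (max_statistic_ge eta x y' kn).
by rewrite ler_wpM2l ?sqrtr_ge0// le_nn_estimator.
Qed.

(* Ties may make the number of terms in the k-th average exceed k, but k always
   exceeds the number of points strictly closer to 0 than the k-th. *)
Lemma max_statistic_le_prefix (eta : R) x y (B : R) : (0 < n)%N -> 0 <= B ->
  (forall j, `|x j| < eta ->
     `|\sum_(i | `|x i| <= `|x j|) y i| <= B * Num.sqrt (near_count x `|x j|).+1%:R) ->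
  max_statistic eta x y <= B.
Proof.
move=> n0 B0 hB; apply: max_statistic_le => // k kn; have /andP[k0 _] := kn.
rewrite /nn_estimator; case: ifPn => [|_]; last by rewrite mulr0.
have [j kj] := kth_least_abs_mem x kn; rewrite kj => /hB hj.
have kR : 0 < k%:R :> R by rewrite ltr0n.
have sk : 0 < Num.sqrt k%:R :> R by rewrite sqrtr_gt0.
rewrite mulrA -[X in _ * X^-1](sqr_sqrtr (ltW kR)) expr2 invfM mulrA divff ?gt_eqF// mul1r.
rewrite mulrC ler_pdivrMr//; apply: (le_trans (ler_norm _)); apply: (le_trans hj).
rewrite ler_wpM2l// ler_wsqrtr// ler_nat ltnNge; apply/negP => kc.
by move: kc; rewrite -kth_least_abs_lt// kj ltxx.
Qed.

(** With [k] the number of points in the ball, the points averaged are exactly those of the ball, so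
    the signal is at least [m] per point and the noise is a single prefix sum. *)
Lemma max_statistic_ge_near (eta : R) x (g y : 'I_n -> R) (r m lam : R) : r <= eta ->
  (0 < near_count x r)%N -> (forall i, `|x i| < r -> m <= g i) ->
  ~~ excursion x y r lam ->
  Num.sqrt (near_count x r)%:R * m - lam / Num.sqrt (near_count x r)%:R <=
  max_statistic eta x (fun i => g i + y i).
Proof.
move=> reta N0 gm; set N := near_count x r; rewrite negb_exists => /forallP noexc.
have kn : (0 < N <= n)%N by rewrite N0 near_count_max.
have [j kj] := kth_least_abs_mem x kn.
have jr : `|x j| < r by rewrite -kj kth_least_abs_lt.
apply: le_trans (max_statistic_ge eta x _ kn).
rewrite /nn_estimator kj (lt_le_trans jr reta).
(* A point of the ball beyond the [N]-th would have [N] points strictly closer, all in the ball,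
   which would then hold more than [N] points. *)
have prefix i : (`|x i| <= `|x j|) = (`|x i| < r).
  apply/idP/idP => [ij|ir]; first exact: le_lt_trans jr.
  rewrite leNgt -kj kth_least_abs_lt//; apply/negP => Ni.
  have : (near_count x `|x i| < N)%N.
    apply: proper_card; rewrite properE; apply/andP; split.
      by apply/fintype.subsetP => i'; rewrite !inE => /lt_trans; apply.
    apply/negP => /fintype.subsetP/(_ i); rewrite !inE ir ltxx.
    by move=> /(_ isT).
  by rewrite ltnNge Ni.
have kR : 0 < N%:R :> R by rewrite ltr0n.
have sk : 0 < Num.sqrt N%:R :> R by rewrite sqrtr_gt0.
have sumg : N%:R * m <= \sum_(i | `|x i| <= `|x j|) g i.
  rewrite /N /near_count -sum1_card natr_sum mulr_suml.
  rewrite (eq_bigl (fun i => `|x i| < r)) => [|i]; last by rewrite inE.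
  rewrite [leRHS](eq_bigl _ _ prefix); apply: ler_sum => i /gm.
  by rewrite mul1r.
have sumy : - lam <= \sum_(i | `|x i| <= `|x j|) y i.
  by have := noexc j; rewrite jr /= -leNgt ler_norml => /andP[].
have -> : Num.sqrt N%:R * m - lam / Num.sqrt N%:R = (N%:R * m - lam) / Num.sqrt N%:R.
  move: (sqr_sqrtr (ltW kR)) sk; move: (Num.sqrt N%:R) => s <- s0; field.
  by rewrite gt_eqF.
have -> : Num.sqrt N%:R * (N%:R^-1 * \sum_(i | `|x i| <= `|x j|) (g i + y i)) =
    (\sum_(i | `|x i| <= `|x j|) (g i + y i)) / Num.sqrt N%:R.
  move: (\sum_(i | _) _) => S.
  move: (sqr_sqrtr (ltW kR)) sk; move: (Num.sqrt N%:R) => s <- s0; field.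
  by rewrite gt_eqF.
rewrite ler_pM2r ?invr_gt0// big_split/=.
by move: sumg sumy; lra.
Qed.

End order_statistics.

Section statistic_measurable.
Context d (T : measurableType d) (R : realType) (n : nat) (eta : R).
Variables (x y : 'I_n -> T -> R).
Hypothesis mx : forall i, measurable_fun setT (x i).
Hypothesis my : forall i, measurable_fun setT (y i).

Let mcount (r : T -> R) : measurable_fun setT r ->
  measurable_fun setT (fun w => (near_count (x^~ w) (r w))%:R : R).
Proof.
move=> mr.
under eq_fun => w do rewrite (near_countE _ (y^~ w)).
apply: measurable_sum => i; apply: measurable_fun_ifT => //.
by apply: measurable_fun_ltr => //; exact: measurableT_comp.
Qed.

Lemma measurable_nn_estimator k : (0 < k <= n)%N ->
  measurable_fun setT (fun w => nn_estimator eta (x^~ w) (y^~ w) k).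
Proof.
move=> kn; under eq_fun => w.
  rewrite nn_estimatorE// -(ler_nat R).
  under eq_bigr do rewrite -(ltr_nat R).
  over.
apply: measurable_fun_ifT => //.
  by apply: measurable_fun_ler => //; exact: mcount.
apply: measurable_funM => //; apply: measurable_sum => j.
apply: measurable_fun_ifT => //; apply: measurable_fun_ltr => //; apply: mcount.
exact: measurableT_comp.
Qed.

Lemma measurable_max_statistic : (0 < n)%N ->
  measurable_fun setT (fun w => max_statistic eta (x^~ w) (y^~ w)).
Proof.
move=> n0.
have mf k : (0 < k <= n)%N ->
    measurable_fun setT (fun w => Num.sqrt k%:R * nn_estimator eta (x^~ w) (y^~ w) k).
  by move=> kn; apply: measurable_funM => //; exact: measurable_nn_estimator.
rewrite /max_statistic.
have : {subset index_iota 1 n.+1 <= [pred k | (0 < k <= n)%N]}.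
  by move=> k; rewrite mem_index_iota ltnS.
elim: (index_iota 1 n.+1) => [_|k s IHs sub].
  by under eq_fun do rewrite big_nil; apply: mf; rewrite n0.
under eq_fun do rewrite big_cons.
apply: measurable_maxr.
  by apply: mf; apply: (sub k); rewrite mem_head.
by apply: IHs => j js; apply: sub; rewrite inE js orbT.
Qed.

End statistic_measurable.

(** * Quantiles and the level *)

Section quantile.
Context d (Omega : measurableType d) (R : realType) (P : probability Omega R).
Variables (T : Omega -> R) (p : R).
Hypothesis mT : measurable_fun setT T.
Hypothesis p01 : 0 < p < 1.

Let TRV : {RV P >-> R} := mfun_Sub (mem_set mT).

Let S := [set t | (p%:E <= P [set w | (T w <= t)%R])%E].

Let mono (s t : R) : s <= t ->
  (P [set w | (T w <= s)%R] <= P [set w | (T w <= t)%R])%E.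
Proof. exact: (@cdf_nondecreasing _ _ _ P TRV). Qed.

Let S_nonempty : S !=set0.
Proof.
have /andP[_ p1] := p01.
have : \forall t \near +oo, (p%:E < cdf TRV t)%E.
  have H := cvg_cdfy1 TRV; apply: (H [set y | (p%:E < y)%E]); apply: open_nbhs_nbhs; split; last by rewrite /= lte_fin.
  exact: open_ereal_gt_ereal.
case => A [Ar hA]; exists (A + 1); apply: ltW; apply: hA.
by rewrite ltrDl.
Qed.

Let S_lbound : has_lbound S.
Proof.
have /andP[p0 _] := p01.
have : \forall t \near -oo, (cdf TRV t < p%:E)%E.
  have H := cvg_cdfNy0 TRV; apply: (H [set y | (y < p%:E)%E]); apply: open_nbhs_nbhs; split; last by rewrite /= lte_fin.
  exact: open_ereal_lt_ereal.
case => A [Ar hA]; exists (A - 1) => t St; rewrite leNgt; apply/negP => tA.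
have := hA (A - 1); rewrite gtrBl ltr01 => /(_ isT).
by rewrite ltNge (le_trans St)//; exact: mono (ltW tA).
Qed.

Lemma quantile_le t : (p%:E <= P [set w | (T w <= t)%R])%E -> quantile P T p <= t.
Proof. by move=> St; exact: ge_inf. Qed.

(** Right continuity of the distribution function puts the infimum itself in the set, which is what
    a test rejecting strictly above it needs. *)
Lemma quantile_attained : (p%:E <= P [set w | (T w <= quantile P T p)%R])%E.
Proof.
rewrite leNgt; apply/negP => h; set q := quantile P T p in h.
have : \forall t \near q^'+, (cdf TRV t < p%:E)%E.
  have H := @cdf_right_continuous _ _ _ P TRV q; apply: (H [set y | (y < p%:E)%E]); apply: open_nbhs_nbhs; split => //.
  exact: open_ereal_lt_ereal.
case => e /= e0 he.
have [s Ss sq] := inf_adherent e0 (conj S_nonempty S_lbound).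
have qs : q <= s by exact: quantile_le.
have [qs'|qs'] := eqVneq q s; first by move: h; rewrite qs' ltNge Ss.
have : (cdf TRV s < p%:E)%E.
  apply: he; last by rewrite lt_neqAle qs' qs.
  by rewrite /ball/= ltr_norml; apply/andP; split; move: sq qs; rewrite -/(quantile P T p) -/q; lra.
by rewrite ltNge Ss.
Qed.

End quantile.

(** * Points off the support, and the level of the test *)

Section off_support.
Context (R : realType) (F s2 : R -> R).
Hypothesis F_nd : {homo F : x y / x <= y}.
Context d (Omega : measurableType d) (P : probability Omega R) (n : nat).
Variables (X e : 'I_n -> {RV P >-> R}).
Hypothesis sample : regression_sample F s2 X e.

(** A point off the support lies in a half-open interval with rational ends on which [F] is
    constant; these intervals are countably many and each has probability 0. *)
Lemma off_support_negligible i : P.-negligible [set w | ~ cdf_support F (X i w)].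
Proof.
pose gap (k : nat) : set Omega :=
  if unpickle k is Some (a, b) then
    if ratr a <= ratr b :> R then
      if F (ratr b) <= F (ratr a) then X i @^-1` `]ratr a, ratr b] else set0
    else set0
  else set0.
apply: (@negligibleS _ _ _ _ (\bigcup_k gap k)); last first.
  apply: negligible_bigcup => k; rewrite /gap.
  case: unpickle => [[a b]|]; last exact: negligible_set0.
  case: ifPn => [ab|_]; last exact: negligible_set0.
  case: ifPn => [Fba|_]; last exact: negligible_set0.
  apply/negligibleP; first exact: measurable_sfunP.
  apply: (etrans (prob_itvoc sample i ab)).
  by congr (_%:E); apply/eqP; rewrite subr_eq0 eq_le Fba F_nd.
move=> w /= /existsNP[r /not_implyP[r0 /negP]]; rewrite -leNgt => Fr.
have [a] := rat_in_itvoo (ltac:(rewrite gtrBl; exact: r0) : X i w - r < X i w).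
rewrite in_itv/= => /andP[a1 a2].
have [b] := rat_in_itvoo (ltac:(rewrite ltrDl; exact: r0) : X i w < X i w + r).
rewrite in_itv/= => /andP[b1 b2].
exists (pickle (a, b)); first exact: Logic.I.
rewrite /gap pickleK.
rewrite (ltW (lt_trans a2 b1)) (le_trans (F_nd (ltW b2)))//; last first.
  exact: le_trans Fr (F_nd (ltW a1)).
by rewrite /= in_itv/= a2 ltW.
Qed.

Lemma measurable_Tn (eta : R) (g : R -> R) : (0 < n)%N ->
  measurable_fun setT g -> measurable_fun setT (Tn eta X e g).
Proof.
move=> n0 mg; apply: measurable_max_statistic => // i; apply: measurable_funD => //.
exact: measurableT_comp.
Qed.

Lemma measurable_Tn_gt (eta c : R) (g : R -> R) : (0 < n)%N ->
  measurable_fun setT g -> measurable [set w | (c < Tn eta X e g w)%R].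
Proof.
move=> n0 mg; apply: measurable_set_bool; apply: measurable_fun_ltr => //.
exact: measurable_Tn.
Qed.

Lemma rejection_probE (eta alpha : R) (g : R -> R) : (0 < n)%N ->
  measurable_fun setT g ->
  rejection_prob eta alpha X e g =
  P [set w | (critical_value eta alpha X e < Tn eta X e g w)%R].
Proof.
by move=> n0 mg; rewrite /rejection_prob expectation_indic//; exact: measurable_Tn_gt.
Qed.

Lemma level (eta alpha : R) (g : R -> R) : 0 < alpha < 1 -> (0 < n)%N ->
  measurable_fun setT g -> (forall x, cdf_support F x -> g x <= 0) ->
  (rejection_prob eta alpha X e g <= alpha%:E)%E.
Proof.
move=> /andP[a0 a1] n0 mg g0; rewrite rejection_probE//.
set c := critical_value _ _ _ _.
have mrej (h : R -> R) : measurable_fun setT h ->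
    measurable [set w | (c < Tn eta X e h w)%R].
  by move=> mh; exact: measurable_Tn_gt.
have p01 : 0 < 1 - alpha < 1 by apply/andP; split; lra.
have mT0 := measurable_Tn eta n0 (measurable_cst (0 : R)).
have : ((1 - alpha)%:E <= P [set w | (Tn eta X e (cst 0) w <= c)%R])%E.
  exact: quantile_attained.
have -> : [set w | (Tn eta X e (cst 0) w <= c)%R] = ~` [set w | (c < Tn eta X e (cst 0) w)%R].
  by apply/seteqP; split=> w /=; rewrite leNgt => /negP.
rewrite probability_setC; last exact: mrej.
move=> lev.
(* [insub] turns the union over the [n] design points into one over the natural numbers, where
   countable subadditivity applies. *)
have [N [mN N0 subN]] : P.-negligible (\bigcup_i
    (if insub i is Some j then [set w | ~ cdf_support F (X j w)] else set0)).
  apply: negligible_bigcup => k; case: insub => [j|]; last exact: negligible_set0.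
  exact: off_support_negligible.
apply: (@le_trans _ _ (P ([set w | (c < Tn eta X e (cst 0) w)%R] `|` N))).
  rewrite le_measure ?inE//; [exact: mrej| |].
    by apply: measurableU => //; exact: mrej.
  move=> w /= rej; have [Nw|Nw] := pselect (N w); [by right|left].
  apply: (lt_le_trans rej); apply: le_max_statistic => // i.
  rewrite lerD2r; apply: g0; apply: contrapT => nsupp; apply: Nw; apply: subN.
  by exists (val i) => //; rewrite valK.
apply: (@le_trans _ _ (P [set w | (c < Tn eta X e (cst 0) w)%R] + P N)%E).
  by apply: measureU2 => //; exact: mrej.
rewrite N0 adde0.
have fin : P [set w | (c < Tn eta X e (cst 0) w)%R] \is a fin_num.
  by rewrite fin_num_measure//; exact: mrej.
by move: lev; rewrite -(fineK fin) -EFinB !lee_fin; lra.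
Qed.

End off_support.

(** * The null distribution *)

Section blocks.
Context (R : realType) (F s2 : R -> R) (eta : R).
Hypothesis s2_ge0 : forall x, 0 <= s2 x.
Hypothesis eta_gt0 : 0 < eta.
Hypothesis F_eta : forall t, 0 < t < eta -> eta * t <= `|F t - F (- t)| <= t / eta.
Hypothesis s2_eta : forall x, `|x| < eta -> eta <= s2 x <= eta^-1.
Variable kappa : R.
Hypothesis kappa_gt0 : 0 < kappa.
Hypothesis normal_moment_le :
  (\int[normal_prob 0 (Num.sqrt eta^-1)]_x (1 + x ^+ 4)%:E <=
   (kappa * eta ^+ 2)%:E)%E.
Context d (Omega : measurableType d) (P : probability Omega R) (n : nat).
Variables (X e : 'I_n -> {RV P >-> R}).
Hypothesis sample : regression_sample F s2 X e.
Hypothesis n_gt0 : (0 < n)%N.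

Let nR_gt0 : 0 < n%:R :> R. Proof. by rewrite ltr0n. Qed.

Let kappaE : kappa * eta ^+ 2 / eta ^+ 2 = kappa.
Proof. by rewrite mulfK// expf_eq0/= gt_eqF. Qed.

Let M_gt0 : 0 < kappa * eta ^+ 2.
Proof. by rewrite mulr_gt0// exprn_gt0. Qed.

(* The factor 32 turns the tail of [excursion_prob], with [2 * kappa * (n * u)]
   for the sum of squares, into [exp (- 2 * l)], that is [(ln n)^-2]. *)
Definition bad_block (x y : 'I_n -> R) (t u l : R) : bool :=
  ((near_count x t)%:R <= n%:R * (eta * t / 4)) ||
  excursion x y (Num.min u eta) (Num.sqrt (32 * kappa * (n%:R * u) * l)).

Lemma measurable_bad_block t u l :
  measurable [set w | bad_block (X^~ w) (e^~ w) t u l].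
Proof.
rewrite (_ : mkset _ =
    [set w | (near_count (X^~ w) t)%:R <= n%:R * (eta * t / 4)] `|`
    [set w | excursion (X^~ w) (e^~ w) (Num.min u eta)
                (Num.sqrt (32 * kappa * (n%:R * u) * l))]).
  apply: measurableU; last exact: measurable_excursion.
  apply: measurable_set_bool; apply: measurable_fun_ler => //.
  under eq_fun => w do rewrite (near_countE _ (e^~ w)).
  exact: measurable_near_sum_comp.
by apply/seteqP; split=> w /= => [/orP[]|[h|h]]; [left|right| |];
  rewrite // /bad_block h ?orbT.
Qed.

(** Three failures: too few points, too large an energy, or an excursion in spite of a moderate
    energy. *)
Lemma bad_block_prob t u l : 0 < t <= eta -> t <= u -> 0 <= l ->
  (P [set w | bad_block (X^~ w) (e^~ w) t u l] <=
   (16 / (eta ^+ 3 * (n%:R * t)) + (kappa * (n%:R * u))^-1 + 4 * expR (- (2 * l)))%:E)%E.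
Proof.
move=> tt tu l0; have /andP[t0 te] := tt.
have u0 : 0 < u by exact: lt_le_trans tu.
pose r := Num.min u eta; pose lam := Num.sqrt (32 * kappa * (n%:R * u) * l).
have rr : 0 < r <= eta by rewrite lt_min u0 eta_gt0 ge_min lexx orbT.
have ru : r <= u by rewrite ge_min lexx.
have v0 : 0 < 2 * kappa * (n%:R * u) by rewrite mulr_gt0 ?mulr_gt0.
have lam0 : 0 <= lam by exact: sqrtr_ge0.
pose A1 := [set w | (near_sum (fun=> 1) (X^~ w) (e^~ w) t <= n%:R * (eta * t / 4))%R].
pose A2 := [set w | (2 * kappa * (n%:R * u) <=
       near_sum (fun y => y ^+ 2) (X^~ w) (e^~ w) r)%R].
pose A3 := [set w | excursion (X^~ w) (e^~ w) r lam &&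
       (near_sum (fun y => y ^+ 2) (X^~ w) (e^~ w) r <= 2 * kappa * (n%:R * u))%R].
have msq : measurable_fun setT (fun w => near_sum (fun y => y ^+ 2) (X^~ w) (e^~ w) r).
  by apply: measurable_near_sum_comp => //; exact: exprn_measurable.
have mA1 : measurable A1.
  apply: measurable_set_bool; apply: measurable_fun_ler => //.
  exact: measurable_near_sum_comp.
have mA2 : measurable A2 by apply: measurable_set_bool; exact: measurable_fun_ler.
have mA3 : measurable A3.
  rewrite (_ : A3 = [set w | excursion (X^~ w) (e^~ w) r lam] `&`
     [set w | (near_sum (fun y => y ^+ 2) (X^~ w) (e^~ w) r <= 2 * kappa * (n%:R * u))%R]).
    apply: measurableI; first exact: measurable_excursion.
    by apply: measurable_set_bool; exact: measurable_fun_ler.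
  by apply/seteqP; split=> w /= => [/andP[]|[h1 h2]]; rewrite /A3/= ?h1.
have h1 : (P A1 <= (16 / (eta ^+ 3 * (n%:R * t)))%:E)%E.
  exact: (near_count_small eta_gt0 F_eta sample n_gt0 tt).
have h2 : (P A2 <= (kappa * (n%:R * u))^-1%:E)%E.
  have := near_energy_large eta_gt0 F_eta s2_eta sample M_gt0 normal_moment_le n_gt0 rr ru.
  by rewrite kappaE.
have h3 : (P A3 <= (4 * expR (- (2 * l)))%:E)%E.
  apply: (le_trans (excursion_prob s2_ge0 sample r v0 lam0)).
  rewrite lee_fin le_eqVlt; apply/orP; left; apply/eqP; congr (4 * expR (- _)).
  rewrite sqr_sqrtr; last by rewrite mulr_ge0// ltW// mulr_gt0// mulr_gt0.
  by field; rewrite !gt_eqF.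
rewrite !EFinD; apply: le_trans (leeD (leeD h1 h2) h3).
apply: (@le_trans _ _ (P ((A1 `|` A2) `|` A3))).
  rewrite le_measure ?inE//; first exact: measurable_bad_block.
    by apply: measurableU => //; exact: measurableU.
  move=> w; rewrite /= /bad_block => /orP[h|h]; first by left; left; rewrite /A1/= -near_countE.
  have [h'|h'] := leP (2 * kappa * (n%:R * u)) (near_sum (fun y => y ^+ 2) (X^~ w) (e^~ w) r).
    by left; right.
  by right; rewrite /A3/= h ltW.
apply: (le_trans (measureU2 _ _ _)) => //; first exact: measurableU.
by rewrite leeD2r// measureU2.
Qed.

(** A point of the shell has at least [n * eta * t / 4] points strictly closer to 0, and the squared
    threshold [64 * kappa * n * t * l] is [256 * (kappa / eta) * l] times this number; 16 is the
    root of 256. *)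
Lemma not_bad_block_prefix x y (t l : R) j : 0 <= l -> 0 < t ->
  ~~ bad_block x y t (2 * t) l -> t <= `|x j| < Num.min (2 * t) eta ->
  `|\sum_(i | `|x i| <= `|x j|) y i| <=
    16 * Num.sqrt (kappa / eta) * Num.sqrt l * Num.sqrt (near_count x `|x j|).+1%:R.
Proof.
move=> l0 t0; rewrite negb_or -ltNge => /andP[hc]; rewrite negb_exists => /forallP/(_ j).
move=> hex /andP[tj ju]; move: hex; rewrite ju /= -leNgt => /le_trans; apply.
set N := near_count _ _.
have hN : n%:R * (eta * t / 4) <= N.+1%:R.
  apply: (le_trans (ltW hc)); rewrite ler_nat.
  by apply: (leq_trans _ (leqnSn _)); exact: near_count_le.
have -> : 16 = Num.sqrt 256 :> R.
  by rewrite (_ : 256 = 16 ^+ 2 :> R) ?sqrtr_sqr ?ger0_norm//; ring.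
have ke : 0 <= kappa / eta by rewrite divr_ge0// ltW.
have k1 : 0 <= 256 * (kappa / eta) by exact: mulr_ge0.
have k2 : 0 <= 256 * (kappa / eta) * l by exact: mulr_ge0.
rewrite -sqrtrM// -sqrtrM// -sqrtrM//.
apply: ler_wsqrtr.
apply: (@le_trans _ _ (256 * (kappa / eta) * l * (n%:R * (eta * t / 4)))).
  by rewrite le_eqVlt; apply/orP; left; apply/eqP; field; rewrite gt_eqF.
exact: ler_wpM2l.
Qed.

Lemma sum_half_le m : \sum_(i < m) (2 ^- i : R) <= 2.
Proof.
suff -> : \sum_(i < m) (2 ^- i : R) = 2 - 2 * 2 ^- m.
  by rewrite gerBl mulr_ge0// invr_ge0 exprn_ge0.
elim: m => [|m IHm]; first by rewrite big_ord0 expr0 invr1 mulr1 subrr.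
rewrite big_ord_recr/= IHm exprS invfM mulrA divff// mul1r.
by lra.
Qed.

(** The innermost ball gives [kappa * K / B0]. Over the shells the polynomial failures form a
    geometric series of order [1 / K], while the exponential one is paid [m] times. The last
    hypothesis makes the shells reach radius [eta]. *)
Lemma null_statistic_tail (K l B0 B : R) m :
  0 < K -> 0 <= l -> 0 < B0 -> B0 <= B ->
  16 * Num.sqrt (kappa / eta) * Num.sqrt l <= B -> eta * n%:R <= K * 2 ^+ m ->
  (P [set w | (B < Tn eta X e (cst 0) w)%R] <=
   (kappa * K / B0 + (32 / (eta ^+ 3 * K) + (kappa * K)^-1) +
    m%:R * (4 * expR (- (2 * l))))%:E)%E.
Proof.
move=> K0 l0 B00 B0B lB Km.
have B_ge0 : 0 <= B by rewrite (le_trans _ B0B)// ltW.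
pose tau i := K * 2 ^+ i / n%:R.
have tau0 i : 0 < tau i by rewrite divr_gt0// mulr_gt0// exprn_gt0.
have tauS i : tau i.+1 = 2 * tau i by rewrite /tau exprS; ring.
have ntau i : n%:R * tau i = K * 2 ^+ i by rewrite /tau mulrC divfK// gt_eqF.
(* Shells starting beyond [eta] hold no point that enters the statistic. *)
pose A i := if tau i <= eta then
  [set w | bad_block (X^~ w) (e^~ w) (tau i) (2 * tau i) l] else set0.
pose r0 := Num.min (tau 0) eta.
have r0P : 0 < r0 <= eta by rewrite lt_min tau0 eta_gt0 ge_min lexx orbT.
pose A0 := [set w | (B0 <= near_sum Num.norm (X^~ w) (e^~ w) r0)%R].
have mA i : measurable (A i) by rewrite /A; case: ifP => // _; exact: measurable_bad_block.
have mA0 : measurable A0.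
  apply: measurable_set_bool; apply: measurable_fun_ler => //.
  exact: measurable_near_sum_comp.
have mUA : measurable (\big[setU/set0]_(i < m) A i) by apply: bigsetU_measurable.
have mT : measurable [set w | (B < Tn eta X e (cst 0) w)%R] by exact: measurable_Tn_gt.
have find_block a : tau 0 <= a -> forall k, a < tau k ->
    exists2 i, (i < k)%N & tau i <= a < tau i.+1.
  move=> ta; elim=> [|k IHk] ak; first by move: ak; rewrite ltNge ta.
  have [ka|/IHk[i ik hi]] := leP (tau k) a; first by exists k => //; rewrite ka.
  by exists i => //; exact: ltnW.
have cover : [set w | (B < Tn eta X e (cst 0) w)%R] `<=` A0 `|` \big[setU/set0]_(i < m) A i.
  move=> w /= Bw; apply: contrapT => /not_orP[nA0 nA].
  move: Bw; rewrite ltNge => /negP; apply.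
  have -> : Tn eta X e (cst 0) w = max_statistic eta (X^~ w) (e^~ w).
    by congr max_statistic; apply/funext => i; rewrite /cst /= add0r.
  apply: max_statistic_le_prefix => // j jeta.
  set x := X^~ w in jeta *; set y := e^~ w.
  have N1 : 1 <= Num.sqrt (near_count x `|x j|).+1%:R :> R.
    by rewrite -[leLHS]sqrtr1 ler_wsqrtr// ler1n.
  have [tj|jt] := leP (tau 0) `|x j|.
    have [|i im /andP[ti jti]] := find_block _ tj m.
      by apply: (lt_le_trans jeta); rewrite ler_pdivlMr.
    have ibad : ~~ bad_block x y (tau i) (2 * tau i) l.
      apply/negP => bad; apply: nA.
      rewrite -bigcup_mkord; exists i => //; rewrite /A ifT//.
      by rewrite (le_trans ti)// ltW.
    apply: (le_trans (not_bad_block_prefix l0 (tau0 i) ibad _)).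
      by rewrite ti lt_min jeta -tauS jti.
    by rewrite ler_wpM2r ?sqrtr_ge0.
  (* In the innermost ball the prefix sum is at most the sum of the absolute errors, and the root on
     the right is at least 1. *)
  apply: (@le_trans _ _ B); last by rewrite ler_peMr.
  apply: le_trans B0B; apply: (le_trans (ler_norm_sum _ _ _)).
  apply: (@le_trans _ _ (near_sum Num.norm x y r0)).
    rewrite big_mkcond/=; apply: ler_sum => i _; rewrite /near_term.
    case: ifPn => [ij|_]; last by case: ifP.
    by rewrite lt_min (le_lt_trans ij jt) (le_lt_trans ij jeta).
  by rewrite leNgt; apply/negP => h; apply: nA0; rewrite /A0/= ltW.
have PA0 : (P A0 <= (kappa * K / B0)%:E)%E.
  have := near_abs_large eta_gt0 F_eta s2_eta sample normal_moment_le r0P B00.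
  rewrite kappaE => /le_trans; apply; rewrite lee_fin ler_wpM2r ?invr_ge0 ?(ltW B00)//.
  have -> : kappa * K = kappa * (n%:R * tau 0) by rewrite ntau expr0 mulr1.
  by rewrite ler_pM2l// ler_pM2l// ge_min lexx.
have c0 : 0 <= 16 / (eta ^+ 3 * K) + (kappa * (2 * K))^-1.
  have c1 : 0 < eta ^+ 3 * K by rewrite mulr_gt0// exprn_gt0.
  have c2 : 0 < kappa * (2 * K) by rewrite mulr_gt0// mulr_gt0.
  by rewrite addr_ge0// ?divr_ge0// ?invr_ge0 ltW.
have PA i : (P (A i) <= (2 ^- i * (16 / (eta ^+ 3 * K) + (kappa * (2 * K))^-1) +
    4 * expR (- (2 * l)))%:E)%E.
  have p0 : 0 < 2 ^+ i :> R by rewrite exprn_gt0.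
  rewrite /A; case: ifPn => [te|_]; last first.
    by rewrite measure0 lee_fin addr_ge0// mulr_ge0 ?expR_ge0// invr_ge0 ltW.
  apply: (le_trans (bad_block_prob _ _ l0)); first by rewrite tau0.
    by rewrite ler_peMl ?(ltW (tau0 i))// ler1n.
  have e2 : n%:R * (2 * tau i) = 2 * (K * 2 ^+ i) by rewrite mulrCA ntau.
  rewrite lee_fin lerD2r ntau e2 le_eqVlt; apply/orP; left; apply/eqP.
  by field; rewrite !gt_eqF.
apply: (@le_trans _ _ (P (A0 `|` \big[setU/set0]_(i < m) A i))).
  by rewrite le_measure ?inE//; exact: measurableU.
apply: (le_trans (measureU2 _ mA0 mUA)).
rewrite -addrA EFinD; apply: leeD => //.
apply: (le_trans (Boole_inequality _ _)) => //.
apply: (@le_trans _ _ (\sum_(i < m) (2 ^- i * (16 / (eta ^+ 3 * K) +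
    (kappa * (2 * K))^-1) + 4 * expR (- (2 * l)))%:E)%E).
  by apply: lee_sum => i _; exact: PA.
rewrite sumEFin lee_fin big_split/= sumr_const card_ord -[X in _ + X <= _]mulr_natl.
rewrite lerD2r -mulr_suml.
apply: (le_trans (ler_wpM2r c0 (sum_half_le m))).
rewrite le_eqVlt; apply/orP; left; apply/eqP; field.
by rewrite !gt_eqF.
Qed.

End blocks.

(** * Asymptotics *)

Section lnln.
Context {R : realType}.
Implicit Type n : nat.

Lemma lnln_large (A : R) : exists n0 : nat, forall n, (n0 <= n)%N -> A <= ln (ln n%:R).
Proof.
exists (Num.bound (expR (expR A))) => n n0n.
have h : expR (expR A) <= n%:R.
  apply: (@le_trans _ _ (Num.bound (expR (expR A)))%:R); last by rewrite ler_nat.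
  by rewrite ltW// archi_boundP// expR_ge0.
have h1 : expR A <= ln n%:R.
  by rewrite -[leLHS]expRK ler_ln ?posrE ?expR_gt0// (lt_le_trans _ h)// expR_gt0.
by rewrite -[leLHS]expRK ler_ln ?posrE ?expR_gt0// (lt_le_trans _ h1)// expR_gt0.
Qed.

(** As [ln] is at most 0 on every real up to 1, positivity of the iterated logarithm alone excludes
    the degenerate [n]. *)
Lemma lnln_pos n : 0 < ln (ln n%:R) :> R ->
  [/\ (0 < n)%N, ln n%:R = expR (ln (ln n%:R)) :> R &
      n%:R = expR (expR (ln (ln n%:R))) :> R].
Proof.
move=> l0.
have y1 : 1 < ln n%:R :> R by rewrite ltNge; apply/negP => /ln_le0; rewrite leNgt l0.
have n1 : 1 < n%:R :> R.
  by rewrite ltNge; apply/negP => /ln_le0; rewrite leNgt (lt_trans ltr01 y1).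
have yE : ln n%:R = expR (ln (ln n%:R)) :> R.
  by rewrite lnK// posrE (lt_trans ltr01 y1).
split=> //; first by rewrite -(ltr_nat R) (lt_trans ltr01 n1).
by rewrite -yE lnK// posrE (lt_trans ltr01 n1).
Qed.

(** With [n = exp (exp l)], squaring [1 + exp l / 2 <= exp (exp l / 2)] and using [1 + l <= exp l]
    gives a bound quadratic in [l]. *)
Lemma lnln_ratio n : let l := ln (ln n%:R) in 0 < l :> R -> (1 + l) / 4 <= n%:R / l :> R.
Proof.
move=> l l0; have [_ _ nE] := lnln_pos l0.
rewrite ler_pdivlMr// nE -/l.
have y1 : 1 + l <= expR l by exact: expR_ge1Dx.
have y2 : 1 + expR l / 2 <= expR (expR l / 2) by exact: expR_ge1Dx.
have -> : expR (expR l) = expR (expR l / 2) ^+ 2 by rewrite expr2 -expRD; congr expR; lra.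
by move: (expR l) (expR (expR l / 2)) y1 y2 => a b; nra.
Qed.

(** Controls the number of dyadic shells. The factor 2 bounds [1 / ln 2], since
    [exp (1 / 2) <= 2]. *)
Lemma log2_bound n : (0 < n)%N -> exists2 m : nat,
  n%:R <= 2 ^+ m :> R & m%:R <= 1 + 2 * ln n%:R :> R.
Proof.
move=> n0; exists (trunc_log 2 n).+1.
  by rewrite -natrX ler_nat ltnW// trunc_log_ltn.
have h : (2 ^ trunc_log 2 n <= n)%N by exact: trunc_logP.
rewrite -natr1 addrC lerD2l -ler_pdivrMl// -[leLHS]expRK ler_ln ?posrE ?expR_gt0 ?ltr0n//.
apply: (@le_trans _ _ (2 ^ trunc_log 2 n)%:R); last by rewrite ler_nat.
rewrite natrX mulrC expRM_natl lerXn2r ?nnegrE ?expR_ge0//.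
have := expR_ge1Dx (- (2^-1 : R)); rewrite expRN => h2.
have e0 := expR_gt0 (2^-1 : R).
have e1 : expR 2^-1 * (expR 2^-1)^-1 = 1 :> R by rewrite divff// gt_eqF.
by move: (expR 2^-1) ((expR 2^-1)^-1) h2 e0 e1 => a b; nra.
Qed.

End lnln.

(** * Bounds on the critical value and on the power *)

Section asymptotics.
Context (R : realType) (F s2 : R -> R) (eta : R).
Hypothesis s2_ge0 : forall x, 0 <= s2 x.
Hypothesis eta_gt0 : 0 < eta.
Hypothesis F_eta : forall t, 0 < t < eta -> eta * t <= `|F t - F (- t)| <= t / eta.
Hypothesis s2_eta : forall x, `|x| < eta -> eta <= s2 x <= eta^-1.
Variable kappa : R.
Hypothesis kappa_gt0 : 0 < kappa.
Hypothesis normal_moment_le :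
  (\int[normal_prob 0 (Num.sqrt eta^-1)]_x (1 + x ^+ 4)%:E <=
   (kappa * eta ^+ 2)%:E)%E.

(** The second term is the constant of [not_bad_block_prefix]; the 1 leaves room for the threshold
    [Num.sqrt l] of the innermost ball. *)
Definition null_constant : R := 1 + 16 * Num.sqrt (kappa / eta).

Lemma null_constant_ge1 : 1 <= null_constant.
Proof. by rewrite lerDl mulr_ge0// sqrtr_ge0. Qed.

Context d (Omega : measurableType d) (P : probability Omega R) (n : nat).
Variables (X e : 'I_n -> {RV P >-> R}).
Hypothesis sample : regression_sample F s2 X e.
Let l : R := ln (ln n%:R).
Hypothesis l_gt0 : 0 < l.

(** [alpha] is split in thirds, one per failure term: the geometric series is made small by [K], the
    innermost ball and the exponential terms by [l]. *)
Lemma critical_value_le (alpha K : R) : 0 < alpha < 1 -> eta <= K ->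
  32 / (eta ^+ 3 * K) + (kappa * K)^-1 <= alpha / 3 ->
  kappa * K / Num.sqrt l <= alpha / 3 -> 12 / (1 + l) <= alpha / 3 ->
  critical_value eta alpha X e <= null_constant * Num.sqrt l.
Proof.
move=> /andP[a0 a1] etaK h1 h2 h3.
have [n0 yE nE] := lnln_pos l_gt0.
have K0 : 0 < K by exact: lt_le_trans etaK.
have sl0 : 0 < Num.sqrt l by rewrite sqrtr_gt0.
have [m nm my] := log2_bound (R := R) n0.
set B := null_constant * Num.sqrt l.
have B1 : Num.sqrt l <= B by rewrite ler_peMl ?null_constant_ge1// ltW.
have B2 : 16 * Num.sqrt (kappa / eta) * Num.sqrt l <= B.
  by rewrite ler_pM2r// /null_constant lerDr.
have etaKm : eta * n%:R <= K * 2 ^+ m by apply: ler_pM => //; exact: ltW.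
have tail := null_statistic_tail s2_ge0 eta_gt0 F_eta s2_eta kappa_gt0
  normal_moment_le sample n0 K0 (ltW l_gt0) sl0 B1 B2 etaKm.
(* At most [3 * ln n] shells, each contributing [4 / (ln n) ^+ 2], where [ln n = exp l >= 1 + l]. *)
have m_le : m%:R * (4 * expR (- (2 * l))) <= 12 / (1 + l).
  have y1 : 1 + l <= expR l by exact: expR_ge1Dx.
  have l1 : 0 < 1 + l by rewrite addr_gt0.
  have -> : expR (- (2 * l)) = (expR l)^-1 * (expR l)^-1.
    by rewrite -expRN -expRD; congr expR; ring.
  rewrite -/l in yE; rewrite yE in my.
  apply: (@le_trans _ _ (12 / expR l)); last first.
    by rewrite ler_wpM2l// lef_pV2 ?posrE ?expR_gt0.
  apply: (@le_trans _ _ (3 * expR l * (4 * ((expR l)^-1 * (expR l)^-1)))).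
    rewrite ler_wpM2r ?mulr_ge0 ?invr_ge0 ?expR_ge0//.
    by move: my y1 l_gt0; lra.
  by rewrite le_eqVlt; apply/orP; left; apply/eqP; field; rewrite gt_eqF ?expR_gt0.
have p01 : 0 < 1 - alpha < 1 by apply/andP; split; lra.
apply: quantile_le => //; first exact: measurable_Tn.
have mrej : measurable [set w | (B < Tn eta X e (cst 0) w)%R] by exact: measurable_Tn_gt.
have -> : [set w | (Tn eta X e (cst 0) w <= B)%R] = ~` [set w | (B < Tn eta X e (cst 0) w)%R].
  by apply/seteqP; split=> w /=; rewrite leNgt => /negP.
rewrite probability_setC//.
have fin : P [set w | (B < Tn eta X e (cst 0) w)%R] \is a fin_num by rewrite fin_num_measure.
move: tail; rewrite -(fineK fin) -EFinB !lee_fin.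
by move: h1 h2 h3 m_le; lra.
Qed.

Lemma measurable_Holder (L beta : R) (g : R -> R) : 0 < L -> 0 < beta ->
  Holder_class L beta g -> measurable_fun setT g.
Proof.
move=> L0 b0 gH; apply: continuous_measurable_fun => x.
apply/cvgrPdist_lt => eps eps0.
have r0 : 0 < (eps / L) `^ beta^-1 by apply: powR_gt0; exact: divr_gt0.
near=> x'; apply: (le_lt_trans (gH x x')).
have xx' : `|x - x'| < (eps / L) `^ beta^-1.
  by near: x'; exact: cvgr_dist_lt.
rewrite mulrC -ltr_pdivlMr//.
have -> : eps / L = ((eps / L) `^ beta^-1) `^ beta.
  by rewrite -powRrM mulVf ?gt_eqF// powRr1// divr_ge0// ltW.
by apply: gt0_ltr_powR; rewrite ?nnegrE// ltW.
Unshelve. all: by end_near.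
Qed.

(** [L] pays for the bias on the ball; then come the critical value, the noise and a slack of 1. The
    factor [2 / Num.sqrt eta] inverts the root of [eta / 4] from the lower bound on the count. *)
Definition power_constant (L : R) : R :=
  L + 2 * (null_constant + Num.sqrt (128 * (kappa / eta)) + 1) / Num.sqrt eta.

(** A single block, with both radii equal to [h], has to be good; its failure probability is of
    order [1 / l] because [n * h >= l] for every [beta]. *)
Lemma power_ge (alpha L beta : R) (g : R -> R) : 0 < L -> 0 < beta <= 1 ->
  expR (- (3 * ln eta)) <= (1 + l) / 4 -> 3 <= l ->
  critical_value eta alpha X e <= null_constant * Num.sqrt l ->
  alternative (power_constant L * rate n beta) L beta g ->
  ((1 - (16 / eta ^+ 3 + kappa^-1 + 4) / l)%:E <= rejection_prob eta alpha X e g)%E.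
Proof.
move=> L0 /andP[b0 b1] etal l3 crit [g0 gH].
have [n0 yE nE] := lnln_pos l_gt0.
have n_gt0 : 0 < n%:R :> R by rewrite ltr0n.
have mg := measurable_Holder L0 b0 gH.
have ratio : (1 + l) / 4 <= n%:R / l by exact: lnln_ratio.
set u := n%:R / l in ratio.
have u1 : 1 <= u by move: ratio; lra.
have u0 : 0 < u by exact: lt_le_trans u1.
(* On the scale [v] powers of [u] become linear exponents: below, [h] is [u] to the power [- q] and
   [r] is [h] to the power [beta]. *)
set v := ln u.
have v0 : 0 <= v by exact: ln_ge0.
have uE : expR v = u by rewrite lnK.
(* [u >= eta ^- 3] together with [q >= 3^-1] gives [h <= eta] for all [beta] at once. *)
have etav : - (3 * ln eta) <= v.
  by rewrite -ler_expR uE (le_trans etal).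
have den0 : 0 < 2 * beta + 1 by lra.
have den1 : (2 * beta + 1)^-1 <= 1 by rewrite invf_le1//; lra.
have den3 : 3^-1 <= (2 * beta + 1)^-1 by rewrite lef_pV2 ?posrE//; lra.
pose q := (2 * beta + 1)^-1.
have q0 : 0 < q by rewrite invr_gt0.
have qE : 2 * beta * q = 1 - q.
  by rewrite /q; field; rewrite gt_eqF.
pose h := expR (- (q * v)).
have h0 : 0 < h by exact: expR_gt0.
pose r := expR (- (beta * q * v)).
have rE : rate n beta = r.
  by rewrite /rate -/l -/u /powR gt_eqF// -/v /r; congr expR; rewrite /q; ring.
have hr : h `^ beta = r by rewrite /h -expRM /r; congr expR; ring.
have heta : h <= eta.
  rewrite -[leRHS]lnK ?posrE// ler_expR.
  have : 3^-1 * v <= q * v by rewrite ler_wpM2r.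
  by move: etav; lra.
have nh : l <= n%:R * h.
  have -> : n%:R = l * expR v by rewrite uE /u mulrC divfK// gt_eqF.
  rewrite -mulrA ler_peMr ?(ltW l_gt0)// -expRD -[leLHS]expR0 ler_expR.
  have : q * v <= 1 * v by rewrite ler_wpM2r.
  by lra.
(* The balance that defines the radius: [n] times [h] to the power [2 * beta + 1] is [l]. *)
have nhr : n%:R * h * r ^+ 2 = l.
  have -> : n%:R = l * expR v by rewrite uE /u mulrC divfK// gt_eqF.
  rewrite expr2 /h /r -!mulrA -!expRD.
  have -> : v + (- (q * v) + (- (beta * (q * v)) - beta * (q * v))) = 0.
    have -> : v + (- (q * v) + (- (beta * (q * v)) - beta * (q * v))) =
       (1 - q - 2 * beta * q) * v by ring.
    by rewrite qE subrr mul0r.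
  by rewrite expR0 mulr1.
have bad_le : (P [set w | bad_block eta kappa (X^~ w) (e^~ w) h h l] <=
    ((16 / eta ^+ 3 + kappa^-1 + 4) / l)%:E)%E.
  have hh : 0 < h <= eta by rewrite h0.
  apply: (le_trans (bad_block_prob s2_ge0 eta_gt0 F_eta s2_eta kappa_gt0
    normal_moment_le sample n0 hh (lexx h) (ltW l_gt0))).
  have nh0 : 0 < n%:R * h by rewrite mulr_gt0.
  have inv_nh : (n%:R * h)^-1 <= l^-1 by rewrite lef_pV2 ?posrE.
  have e3 : 0 < eta ^+ 3 by rewrite exprn_gt0.
  rewrite lee_fin [leRHS]mulrDl [X in _ <= X + _]mulrDl; apply: lerD; [apply: lerD|].
  - have -> : 16 / (eta ^+ 3 * (n%:R * h)) = 16 / eta ^+ 3 * (n%:R * h)^-1.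
      by rewrite [in LHS]invfM mulrA.
    by rewrite ler_wpM2l// divr_ge0// ltW.
  - by rewrite invfM ler_wpM2l// invr_ge0 ltW.
  - rewrite ler_wpM2l// expRN lef_pV2 ?posrE ?expR_gt0//.
    by apply: (le_trans _ (expR_ge1Dx _)); lra.
rewrite rejection_probE//.
have mbad := measurable_bad_block eta kappa X e h h l.
apply: (@le_trans _ _ (P (~` [set w | bad_block eta kappa (X^~ w) (e^~ w) h h l]))).
  rewrite probability_setC//.
  have fin : P [set w | bad_block eta kappa (X^~ w) (e^~ w) h h l] \is a fin_num.
    by rewrite fin_num_measure.
  by move: bad_le; rewrite -(fineK fin) -EFinB !lee_fin; lra.
rewrite le_measure ?inE//; [exact: measurableC|exact: measurable_Tn_gt|].
move=> w /= /negP; rewrite /bad_block negb_or -ltNge => /andP[hN].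
rewrite (min_idPl heta); set lam := Num.sqrt _ => noexc.
apply: (le_lt_trans crit).
set x := X^~ w in hN noexc *; set y := e^~ w in noexc.
set N := near_count x h in hN.
pose N0 := n%:R * (eta * h / 4).
have N00 : 0 < N0 by rewrite mulr_gt0// divr_gt0// mulr_gt0.
have NR0 : 0 < N%:R :> R by exact: lt_trans hN.
have Npos : (0 < N)%N by rewrite -(ltr_nat R).
(* On the ball [g] falls below [g 0] by at most [L * r]. *)
have gm i : `|x i| < h -> (power_constant L - L) * r <= g (x i).
  move=> xh; have := gH 0 (x i); rewrite sub0r normrN => gd.
  have : `|x i| `^ beta <= r.
    by rewrite -hr; apply: ge0_ler_powR; rewrite ?nnegrE// ltW.
  move=> /(ler_wpM2l (ltW L0)) Lr.
  have := ler_norm (g 0 - g (x i)); move: g0; rewrite rE mulrBl.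
  by lra.
have := max_statistic_ge_near (g := g \o x) heta Npos gm noexc.
apply: lt_le_trans; rewrite -/N.
have sN0 : 0 < Num.sqrt N0 by rewrite sqrtr_gt0.
have sNN : Num.sqrt N0 <= Num.sqrt N%:R by rewrite ler_wsqrtr// ltW.
have sN : 0 < Num.sqrt N%:R :> R by exact: lt_le_trans sNN.
have ke0 : 0 <= 128 * (kappa / eta) by rewrite mulr_ge0// divr_ge0// ltW.
have sl0 : 0 < Num.sqrt l by rewrite sqrtr_gt0.
have se0 : 0 < Num.sqrt eta by rewrite sqrtr_gt0.
(* [32 * kappa * n * h * l] divided by [n * eta * h / 4] is [128 * (kappa / eta) * l]. *)
have lam_le : lam / Num.sqrt N%:R <= Num.sqrt (128 * (kappa / eta)) * Num.sqrt l.
  apply: (@le_trans _ _ (lam / Num.sqrt N0)).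
    by rewrite ler_wpM2l ?sqrtr_ge0// lef_pV2 ?posrE.
  rewrite ler_pdivrMr// -sqrtrM// -sqrtrM; last by rewrite mulr_ge0// ltW.
  rewrite le_eqVlt; apply/orP; left; apply/eqP; congr Num.sqrt; rewrite /N0.
  by field; rewrite gt_eqF.
have r0 : 0 < r by exact: expR_gt0.
have sNr : Num.sqrt eta * Num.sqrt l / 2 <= Num.sqrt N%:R * r.
  apply: (@le_trans _ _ (Num.sqrt N0 * r)); last by rewrite ler_pM2r.
  have NrE : N0 * r ^+ 2 = eta * l * 2^-1 ^+ 2 by rewrite -nhr /N0; field.
  have -> : Num.sqrt N0 * r = Num.sqrt (N0 * r ^+ 2).
    by rewrite (sqrtrM _ (ltW N00)) sqrtr_sqr ger0_norm// ltW.
  have el0 : 0 <= eta * l by rewrite mulr_ge0// ltW.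
  by rewrite NrE (sqrtrM _ el0) sqrtr_sqr ger0_norm// (sqrtrM _ (ltW eta_gt0)).
have C0 : 0 <= power_constant L - L.
  rewrite /power_constant addrC addKr divr_ge0 ?sqrtr_ge0// mulr_ge0//.
  by rewrite addr_ge0// addr_ge0 ?sqrtr_ge0// (le_trans ler01) ?null_constant_ge1.
have main : (null_constant + Num.sqrt (128 * (kappa / eta)) + 1) * Num.sqrt l <=
    Num.sqrt N%:R * ((power_constant L - L) * r).
  rewrite [leRHS]mulrCA; apply: (le_trans _ (ler_wpM2l C0 sNr)).
  rewrite /power_constant [L + _]addrC addrK.
  by rewrite le_eqVlt; apply/orP; left; apply/eqP; field; rewrite gt_eqF.
(* The slack [Num.sqrt l > 0] makes the inequality strict, as rejection demands. *)
by move: main lam_le sl0; rewrite 2!mulrDl mul1r; lra.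
Qed.

End asymptotics.

Theorem theorem2p2 (R : realType)
    (F : cumulativeBounded (0 : R) (1 : R)) (s2 : R -> R) (eta : R)
    (ms2 : measurable_fun [set: R] s2) (s2_ge0 : forall x, 0 <= s2 x)
    (eta_gt0 : 0 < eta)
    (F_eta : forall t, 0 < t < eta ->
       eta * t <= `|F t - F (- t)| <= t / eta)
    (s2_eta : forall x, `|x| < eta -> eta <= s2 x <= eta^-1)
    (d : nat -> measure_display) (Omega : forall n, measurableType (d n))
    (P : forall n, probability (Omega n) R)
    (X e : forall n, 'I_n -> {RV (P n) >-> R})
    (sample : forall n, regression_sample F s2 (X n) (e n))
    (alpha L : R) (alpha01 : 0 < alpha < 1) (L_gt0 : 0 < L) :
  (forall (n : nat) (g : R -> R), (0 < n)%N -> measurable_fun [set: R] g ->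
     (forall x, cdf_support F x -> g x <= 0) ->
     (rejection_prob eta alpha (X n) (e n) g <= alpha%:E)%E)
  /\
  exists C : R, forall eps : R, 0 < eps <= 1 ->
    ereal_inf [set ereal_inf [set rejection_prob eta alpha (X n) (e n) g
                             | g in alternative (C * rate n beta) L beta]
              | beta in [set beta | eps <= beta <= 1]]
      @[n --> \oo] --> 1%:E.
Proof.
have [alpha0 alpha1] := andP alpha01.
have F_nd : {homo F : x y / x <= y} by exact: cumulative_is_nondecreasing.
split=> [n g n0 mg g0|]; first exact: (level F_nd (sample n)).
have [M M0 Mle] : exists2 M : R, 0 < M &
    (\int[normal_prob 0 (Num.sqrt eta^-1)]_x (1 + x ^+ 4)%:E <= M%:E)%E.
  by apply: normal_fourth_moment; rewrite sqrtr_gt0 invr_gt0.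
pose kappa := M / eta ^+ 2.
have e3 : 0 < eta ^+ 3 by rewrite exprn_gt0.
have kappa0 : 0 < kappa by rewrite divr_gt0// exprn_gt0.
have kappaM : (\int[normal_prob 0 (Num.sqrt eta^-1)]_x (1 + x ^+ 4)%:E <=
    (kappa * eta ^+ 2)%:E)%E.
  by rewrite /kappa divfK// expf_eq0/= gt_eqF.
(* The constant is built from [eta], [L] and the Gaussian moment bound, so it serves every [eps]. *)
exists (power_constant eta kappa L) => eps /andP[eps0 eps1].
pose l n : R := ln (ln n%:R).
pose c := 32 / eta ^+ 3 + kappa^-1.
have c0 : 0 < c by rewrite addr_gt0 ?divr_gt0 ?invr_gt0.
(* The second term gives [c / K <= alpha / 3]; the first gives [eta <= K], so that [m] shells reach
   [eta] once [n <= 2 ^+ m]. *)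
pose K := eta + c * (3 / alpha).
have K0 : 0 < K by rewrite addr_gt0// mulr_gt0// divr_gt0.
have etaK : eta <= K by rewrite lerDl mulr_ge0 ?divr_ge0// ltW.
have cK : 32 / (eta ^+ 3 * K) + (kappa * K)^-1 <= alpha / 3.
  have -> : 32 / (eta ^+ 3 * K) + (kappa * K)^-1 = c / K.
    by rewrite /c; field; rewrite !gt_eqF.
  rewrite ler_pdivrMr//.
  have : alpha / 3 * (c * (3 / alpha)) <= alpha / 3 * K.
    by rewrite ler_pM2l ?divr_gt0// lerDr ltW.
  apply: le_trans; rewrite le_eqVlt; apply/orP; left; apply/eqP.
  by field; rewrite gt_eqF.
pose D := 16 / eta ^+ 3 + kappa^-1 + 4.
pose A1 := kappa * K * (3 / alpha).
(* Lower bounds for [l], in order: for [n / l >= 1], for the innermost ball, for the exponential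
   terms, and for [h <= eta]. *)
pose A := 3 + A1 ^+ 2 + 36 / alpha + 4 * expR (- (3 * ln eta)).
have A1_ge0 : 0 <= A1 by rewrite ltW// mulr_gt0 ?divr_gt0// mulr_gt0.
have [n1 hn1] := lnln_large A.
have bound n : (n1 <= n)%N -> forall beta g, eps <= beta <= 1 ->
    alternative (power_constant eta kappa L * rate n beta) L beta g ->
    ((1 - D / l n)%:E <= rejection_prob eta alpha (X n) (e n) g)%E.
  move=> nn1 beta g /andP[eb b1] galt.
  have a36 : 0 < 36 / alpha by rewrite divr_gt0.
  have ex0 := expR_gt0 (- (3 * ln eta)).
  have A1sq := sqr_ge0 A1.
  have lA : A <= l n by exact: hn1.
  have l3 : 3 <= l n by move: lA; rewrite /A; lra.
  have lpos : 0 < l n by lra.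
  have crit : critical_value eta alpha (X n) (e n) <= null_constant eta kappa * Num.sqrt (l n).
    apply: (critical_value_le s2_ge0 eta_gt0 F_eta s2_eta kappa0 kappaM (sample n) lpos alpha01 etaK cK).
    - rewrite ler_pdivrMr ?sqrtr_gt0//.
      have A1l : A1 <= Num.sqrt (l n).
        rewrite -[leLHS]ger0_norm// -sqrtr_sqr ler_wsqrtr//.
        by move: lA; rewrite /A; lra.
      have : alpha / 3 * A1 <= alpha / 3 * Num.sqrt (l n) by rewrite ler_pM2l// divr_gt0.
      apply: le_trans; rewrite le_eqVlt; apply/orP; left; apply/eqP.
      by rewrite /A1; field; rewrite gt_eqF.
    - rewrite ler_pdivrMr ?addr_gt0//.
      have : alpha / 3 * (36 / alpha) <= alpha / 3 * (1 + l n).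
        by rewrite ler_pM2l ?divr_gt0//; move: lA; rewrite /A; lra.
      apply: le_trans; rewrite le_eqVlt; apply/orP; left; apply/eqP.
      by field; rewrite gt_eqF.
  have b01 : 0 < beta <= 1 by rewrite (lt_le_trans eps0 eb).
  apply: (power_ge s2_ge0 eta_gt0 F_eta s2_eta kappa0 kappaM (sample n) lpos L_gt0 b01 _ l3 crit galt).
  by rewrite -/(l n); move: lA; rewrite /A; lra.
have D0 : 0 < D by rewrite addr_gt0// addr_gt0 ?divr_gt0 ?invr_gt0.
have lower : (1 - D / l n)%:E @[n --> \oo] --> 1%:E.
  apply: cvg_EFin; first exact: nearW.
  apply/cvgrPdist_lt => r r0.
  have [n2 hn2] := lnln_large (D / r + 1).
  exists n2 => // n /= nn2; have := hn2 n nn2; rewrite -/(l n) => ln_ge.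
  have lpos : 0 < l n by apply: lt_le_trans ln_ge; rewrite addr_gt0// divr_gt0.
  rewrite opprB addrC subrK ger0_norm ?divr_ge0 ?(ltW D0) ?(ltW lpos)//.
  rewrite ltr_pdivrMr// mulrC -ltr_pdivrMr//.
  by apply: lt_le_trans ln_ge; rewrite ltrDl.
apply: (squeeze_cvge _ lower (cvg_cst _)).
exists n1 => // n /= nn1; apply/andP; split.
  apply: le_ereal_inf_tmp => _ [beta hb <-].
  by apply: le_ereal_inf_tmp => _ [g hg <-]; exact: bound hb hg.
have lpos : 0 < l n.
  apply: lt_le_trans (hn1 n nn1); rewrite /A.
  have : 0 < 36 / alpha by rewrite divr_gt0.
  by have := expR_gt0 (- (3 * ln eta)); have := sqr_ge0 A1; lra.
have [n0 _ _] := lnln_pos lpos.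
(* The upper bound 1 needs a member of each index set, since an infimum over the empty set is
   infinite: [beta = eps] and a constant function. *)
pose b := power_constant eta kappa L * rate n eps.
apply: ge_ereal_inf; exists (ereal_inf [set rejection_prob eta alpha (X n) (e n) g
    | g in alternative b L eps]); first by exists eps; rewrite //= lexx.
apply: ge_ereal_inf; exists (rejection_prob eta alpha (X n) (e n) (cst b)).
  exists (cst b) => //; split=> // x x'.
  by rewrite subrr normr0 mulr_ge0 ?powR_ge0//; exact: ltW.
by rewrite rejection_probE// probability_le1//; exact: measurable_Tn_gt.
Qed.
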